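(* Let $\mathfrak g$ be an affine Lie algebra of type $X_N^{(r)}$, $\ell$ a positive integer, and $\mathcal P_\ell$ its truncated polynomial representation. Then $\mathcal P_\ell$ is a projective $\Gamma_1(r)\ltimes\widetilde W^e_\ell$ representation (in particular there is a homomorphism $\Gamma_1(r)\to\mathrm{PGL}(\mathcal P_\ell)$). Moreover, the action of $\Gamma_1(r)$ on $\mathcal P_\ell$ commutes with the action of $\mathring W$.
   Context: Setting. $\mathfrak g$ is an affine Lie algebra of type $X_N^{(r)}$ (Kac's notation) with simple roots $\alpha_0,\dots,\alpha_n$, labels $a_0,\dots,a_n$ and dual Coxeter number $h^\vee$. $\mathring{\mathfrak g}$ is the finite-dimensional simple Lie algebra with simple roots $\alpha_1,\dots,\alpha_n$, with Cartan subalgebra $\mathring{\mathfrak h}$, Weyl group $\mathring W$, and weight, root, coweight and coroot lattices $\mathring P,\mathring Q,\mathring P^\vee,\mathring Q^\vee$. $\langle\cdot,\cdot\rangle$ is the normalized invariant form, used to identify $\mathring{\mathfrak h}$ with $\mathring{\mathfrak h}^*$. Put $M=\mathring Q^\vee$ if $r\le a_0$ and $M=\mathring Q$ if $r>a_0$, and $M^\circ=\{v:\langle v,\lambda\rangle\in\mathbb Z\ \forall\lambda\in M\}$. Let $m$ be the least positive integer with $m\langle M^\circ,\mathring P\rangle\subseteq\mathbb Z$, let $\delta$ be the basic imaginary root of $\mathfrak g$, and let $Q^\vee=\mathring Q^\vee\oplus\mathbb Z\delta$ be the coroot lattice (the canonical central element $K$ being identified with $\delta$). The extended Heisenberg group is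 $\mathcal H^e=\mathring P\ltimes(M^\circ\oplus\frac1m\mathbb Z\delta)$. Its elements are written $(\alpha,\beta,u)$ with $\alpha\in\mathring P$, $\beta\in M^\circ$, $u\delta\in\frac1m\mathbb Z\delta$, where $(\alpha,0,0)=t_\alpha$ (the element $\alpha$ of $\mathring P$), $(0,\beta,0)=p_\beta$ and $(0,0,u)=p_{u\delta}=u\delta$ (elements of the second factor), with multiplication $(\alpha,\beta,u)(\alpha',\beta',u')=(\alpha+\alpha',\beta+\beta',u+u'+\frac12\langle\alpha',\beta\rangle-\frac12\langle\alpha,\beta'\rangle)$, and $(\alpha,\beta,u)=t_\alpha p_\beta p_{(u+\frac12\langle\alpha,\beta\rangle)\delta}$. The finite extended Heisenberg group is $\mathcal H^e_\ell=\mathcal H^e/\big((\ell+h^\vee)M\ltimes(\ell+h^\vee)Q^\vee\big)$, whose elements are also written $(\alpha,\beta,u)$. $\mathring W$ acts on $\mathcal H^e_\ell$ through its actions on the lattices, and the finite extended double affine Weyl group is $\widetilde W^e_\ell=\mathring W\ltimes\mathcal H^e_\ell$. $\Gamma_1(r)$ is the group of matrices in $SL(2,\mathbb Z)$ congruent to $\begin{pmatrix}1&*\\0&1\end{pmatrix}$ modulo $r$. It acts on $\mathcal H^e_\ell$, and on $\widetilde W^e_\ell$ (leaving $\mathring W$ invariant), by $(\alpha,\beta,u)\cdot\begin{pmatrix}a&b\\c&d\end{pmatrix}=(a\alpha+c\beta,\,b\alpha+d\beta,\,u)$. The truncated polynomial representation $\mathcal P_\ell$ is the representation of $\widetilde W^e_\ell$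 induced from the one-dimensional representation of the image of $\mathring W\ltimes(M^\circ\oplus\frac1m\mathbb Z\delta)$ on which $\mathring W$ and all $p_\beta$ act trivially and $u\delta$ acts by $e^{\frac{2\pi i}{\ell+h^\vee}u}$. Concretely $\mathcal P_\ell=\mathbb C[G_\ell]$ with $G_\ell=\mathring P/(\ell+h^\vee)M$, and $w\cdot e^\lambda=e^{w(\lambda)}$, $t_\alpha\cdot e^\lambda=e^{\lambda+\alpha}$, $p_\beta\cdot e^\lambda=e^{\frac{2\pi i}{\ell+h^\vee}\langle\beta,\lambda\rangle}e^\lambda$, $(u\delta)\cdot e^\lambda=e^{\frac{2\pi i}{\ell+h^\vee}u}e^\lambda$ for $w\in\mathring W$, $\alpha,\lambda\in\mathring P$, $\beta\in M^\circ$, $u\in\frac1m\mathbb Z$.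
   Formalization: Γ_1(r) need not preserve H^e (e.g. A_1^(1)) or the subgroup divided out (A_2n^(2), ℓ+h^∨ odd), so the centre is enlarged to (1/2m)Zδ and Γ_1(r)⋉ is formed before division; the projective representation is shown trivial on (ℓ+h^∨)M⋉(ℓ+h^∨)Q^∨. *)

(* Defs.v *)
From HB Require Import structures.
From mathcomp Require Import all_boot all_order all_algebra.
From mathcomp Require Import zify ring.
From mathcomp Require Import complex boolp reals trigo functions.

Set Implicit Arguments.
Unset Strict Implicit.
Unset Printing Implicit Defensive.

Import Order.TTheory GRing.Theory Num.Theory.
Local Open Scope ring_scope.

(* Affine types X_N^(r) with Kac's numbering of the simple roots.  The
   argument is shifted so that every value is a legal type: [A1 p] is
   A_(p+1)^(1), [B1 p] is B_(p+3)^(1), [C1 p] is C_(p+2)^(1), [D1 p] is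
   D_(p+4)^(1), [A2even p] is A_(2l)^(2) with l = p+1, [A2odd p] is
   A_(2l-1)^(2) with l = p+3, and [D2 p] is D_(l+1)^(2) with l = p+2. *)
Inductive affine_type : Type :=
| A1 of nat | B1 of nat | C1 of nat | D1 of nat
| E6_1 | E7_1 | E8_1 | F4_1 | G2_1
| A2even of nat | A2odd of nat | D2 of nat | E6_2 | D4_3.

(* The integer r of X_N^(r). *)
Definition tier (X : affine_type) : nat :=
  match X with
  | A2even _ | A2odd _ | D2 _ | E6_2 => 2
  | D4_3 => 3
  | _ => 1
  end.

(* The integer n: the simple roots are alpha_0, ..., alpha_n. *)
Definition rank (X : affine_type) : nat :=
  match X with
  | A1 p => p.+1 | B1 p => p.+3 | C1 p => p.+2 | D1 p => p.+4
  | E6_1 => 6 | E7_1 => 7 | E8_1 => 8 | F4_1 => 4 | G2_1 => 2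
  | A2even p => p.+1 | A2odd p => p.+3 | D2 p => p.+2 | E6_2 => 4 | D4_3 => 2
  end%N.

Definition consecutive (i j : nat) : bool := (j == i.+1) || (i == j.+1).

(* alpha_0 is attached to alpha_2 instead of alpha_1. *)
Definition forked (i j : nat) : bool :=
  [&& (0 < i)%N, (0 < j)%N & consecutive i j]
  || ((i, j) \in [:: (0, 2); (2, 0)]%N).

Definition edge_of (s : seq (nat * nat)) (i j : nat) : bool :=
  ((i, j) \in s) || ((j, i) \in s).

Definition joined (X : affine_type) (i j : nat) : bool :=
  match X with
  | A1 p => consecutive i j || edge_of [:: (0, p.+1)]%N i j
  | B1 _ | A2odd _ => forked i j
  | D1 p => (forked i j && ~~ edge_of [:: (p.+3, p.+4)]%N i j)
            || edge_of [:: (p.+2, p.+4)]%N i j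
  | E6_1 => edge_of [:: (1, 2); (2, 3); (3, 4); (4, 5); (3, 6); (0, 6)]%N i j
  | E7_1 =>
      edge_of [:: (0, 1); (1, 2); (2, 3); (3, 4); (4, 5); (5, 6); (3, 7)]%N i j
  | E8_1 => edge_of [:: (0, 1); (1, 2); (2, 3); (3, 4); (4, 5); (5, 6); (6, 7);
                        (5, 8)]%N i j
  | _ => consecutive i j
  end.

(* -a_ij for joined nodes, where a_ij = <alpha_i^vee, alpha_j>. *)
Definition multiplicity (X : affine_type) (i j : nat) : nat :=
  match X with
  | A1 0 => 2
  | B1 p => if (i, j) == (p.+3, p.+2) then 2 else 1
  | C1 p => if (i, j) \in [:: (1, 0); (p.+1, p.+2)] then 2 else 1
  | F4_1 => if (i, j) == (3, 2) then 2 else 1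
  | G2_1 => if (i, j) == (2, 1) then 3 else 1
  | A2even 0 => if (i, j) == (0, 1) then 4 else 1
  | A2even p.+1 => if (i, j) \in [:: (0, 1); (p.+1, p.+2)] then 2 else 1
  | A2odd p => if (i, j) == (p.+2, p.+3) then 2 else 1
  | D2 p => if (i, j) \in [:: (0, 1); (p.+2, p.+1)] then 2 else 1
  | E6_2 => if (i, j) == (2, 3) then 2 else 1
  | D4_3 => if (i, j) == (1, 2) then 3 else 1
  | _ => 1
  end%N.

Definition cartan (X : affine_type) (i j : nat) : int :=
  if i == j then 2 else if joined X i j then - (multiplicity X i j)%:Z else 0.

(* The labels a_i and the dual labels a_i^vee of Kac's tables: the coprime
   positive solutions of \sum_j a_ij a_j = 0 and \sum_i a_i^vee a_ij = 0. *)
Definition label (X : affine_type) (i : nat) : nat :=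
  match X with
  | A1 _ | D2 _ => 1
  | B1 _ => if i <= 1 then 1 else 2
  | C1 p => if (i == 0) || (i == p.+2) then 1 else 2
  | D1 p => if (i <= 1) || (p.+3 <= i) then 1 else 2
  | E6_1 => nth 1 [:: 1; 1; 2; 3; 2; 1; 2] i
  | E7_1 => nth 1 [:: 1; 2; 3; 4; 3; 2; 1; 2] i
  | E8_1 => nth 1 [:: 1; 2; 3; 4; 5; 6; 4; 2; 3] i
  | F4_1 => nth 1 [:: 1; 2; 3; 4; 2] i
  | G2_1 => nth 1 [:: 1; 2; 3] i
  | A2even p => if i == p.+1 then 1 else 2
  | A2odd p => if (i <= 1) || (i == p.+3) then 1 else 2
  | E6_2 => nth 1 [:: 1; 2; 3; 2; 1] i
  | D4_3 => nth 1 [:: 1; 2; 1] i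
  end%N.

Definition colabel (X : affine_type) (i : nat) : nat :=
  match X with
  | A1 _ | C1 _ => 1
  | B1 p => if (i <= 1) || (i == p.+3) then 1 else 2
  | F4_1 => nth 1 [:: 1; 2; 3; 2; 1] i
  | G2_1 => nth 1 [:: 1; 2; 1] i
  | A2even _ => if i == 0 then 1 else 2
  | A2odd _ => if i <= 1 then 1 else 2
  | D2 p => if (i == 0) || (i == p.+2) then 1 else 2
  | E6_2 => nth 1 [:: 1; 2; 3; 4; 2] i
  | D4_3 => nth 1 [:: 1; 2; 3] i
  | _ => label X i
  end%N.

Definition dual_coxeter (X : affine_type) : nat :=
  (\sum_(i < (rank X).+1) colabel X i)%N.

Lemma joinedC X i j : joined X i j = joined X j i.
Proof.
have cC a b : consecutive a b = consecutive b a by rewrite /consecutive orbC.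
have fC a b : forked a b = forked b a.
  rewrite /forked !inE !xpair_eqE cC; congr (_ || _); last by rewrite orbC andbC [X in _ || X]andbC.
  by rewrite andbCA.
have eC s a b : edge_of s a b = edge_of s b a by rewrite /edge_of orbC.
by case: X => [p|p|p|p||||||p|p|p||] /=; rewrite ?(cC i) ?(fC i) ?(eC _ i).
Qed.

Lemma multiplicity_sym X i j : (i <= rank X)%N -> (j <= rank X)%N -> joined X i j -> i != j ->
  (colabel X i * label X j * multiplicity X i j =
   colabel X j * label X i * multiplicity X j i)%N.
Proof.
wlog lt_ij: i j / (i < j)%N => [IH hi hj hij ne|].
  case: (ltngtP i j) ne => // h _; first by apply: IH; rewrite // ltn_eqF.
  by apply/esym/IH; rewrite // 1?joinedC // ltn_eqF.
move=> hi hj hij _.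
have small : (rank X <= 8)%N -> all (fun x => all (fun y => joined X x y ==> (colabel X x * label X y * multiplicity X x y ==
   colabel X y * label X x * multiplicity X y x)%N) (iota 0 (rank X).+1)) (iota 0 (rank X).+1) ->
   (colabel X i * label X j * multiplicity X i j =
   colabel X j * label X i * multiplicity X j i)%N.
  move=> _ /allP/(_ i) + ; rewrite mem_iota ltnS hi => /(_ isT) /allP/(_ j).
  by rewrite mem_iota ltnS hj hij => /(_ isT) /eqP.
case: X hi hj hij small => [[|p]|p|p|p||||||[|p]|p|p||] //=;
 try by move=> _ _ _; apply; vm_compute.
all: rewrite /forked /edge_of /consecutive ?inE ?xpair_eqE => hi hj hij _.
- have [?|[? ?]]: j = i.+1 \/ i = 0%N /\ j = 2%N by lia.
    by subst j; case: i lt_ij hi hj hij => [|[|i]] //= *; repeat (case: ifPn => ? /=); lia.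
  by subst i j; rewrite /=; repeat (case: ifPn => ? /=); lia.
- have ?: j = i.+1 by lia. 
  by subst j; case: i lt_ij hi hj hij => [|[|i]] //= *; repeat (case: ifPn => ? /=); lia.
- by rewrite mulnC [in RHS]mulnC; congr (_ * _)%N; rewrite mulnC.
- have ?: j = i.+1 by lia. 
  by subst j; case: i lt_ij hi hj hij => [|[|i]] //= *; repeat (case: ifPn => ? /=); lia.
- have [?|[? ?]]: j = i.+1 \/ i = 0%N /\ j = 2%N by lia.
    by subst j; case: i lt_ij hi hj hij => [|[|i]] //= *; repeat (case: ifPn => ? /=); lia.
  by subst i j; rewrite /=; repeat (case: ifPn => ? /=); lia.
- have ?: j = i.+1 by lia. 
  by subst j; case: i lt_ij hi hj hij => [|[|i]] //= *; repeat (case: ifPn => ? /=); lia.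
Qed.

Lemma label_gt0 X i : (0 < label X i)%N.
Proof.
case: X => [p|p|p|p||||||p|p|p||] //=; try by case: ifP.
all: by do 10 (case: i => [|i] //).
Qed.

Lemma colabel_gt0 X i : (0 < colabel X i)%N.
Proof.
case: X => [p|p|p|p||||||p|p|p||]; rewrite /colabel ?label_gt0 //; try by case: ifP.
all: by do 10 (case: i => [|i] //).
Qed.

Lemma label_dvd X i : ~~ (tier X <= label X 0)%N ->  (0 < i)%N ->
  (label X i %| colabel X i)%N && (colabel X i %| tier X * label X i)%N.
Proof.
case: X => [p|p|p|p||||||p|p|p||] //=; try by case: ifP.
all: case: i => // i _ _; rewrite ?ltnS ?leqn0.
all: try by do 10 (case: i => [|i] //).
by case: ifP; case: ifP.
Qed.

(* From here on, the Cartan subalgebra of the finite-dimensional algebra is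
   identified with its dual by the normalized form, and vectors are columns of
   coordinates in the basis alpha_1, ..., alpha_n.  The index [i : 'I_n]
   stands for the node i+1. *)
Definition vec (X : affine_type) : Type := 'cV[rat]_(rank X).

(* The normalized invariant form (alpha_i | alpha_j) = a_i^vee / a_i * a_ij. *)
Definition gram (X : affine_type) (i j : 'I_(rank X)) : rat :=
  (colabel X i.+1)%:R / (label X i.+1)%:R * (cartan X i.+1 j.+1)%:~R.

Definition form (X : affine_type) (u v : vec X) : rat :=
  \sum_i \sum_j u i 0 * gram i j * v j 0.

Section FiniteRootSystem.
Variable X : affine_type.
Implicit Types (u v : vec X) (i j : 'I_(rank X)).

Definition root i : vec X := delta_mx i 0.

Definition coroot i : vec X := (2 / form (root i) (root i)) *: root i.

Definition reflection i : 'M[rat]_(rank X) :=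
  1%:M - root i *m (\row_j form (root j) (coroot i)).

Lemma gramC i j : gram i j = gram j i.
Proof.
have swap (F : fieldType) (c1 c2 l1 l2 m1 m2 : nat) :
    (c2 * l1 * m2 = c1 * l2 * m1)%N ->
    l1%:R != 0 :> F -> l2%:R != 0 :> F ->
  c1%:R / l1%:R * (- m1%:Z)%:~R = c2%:R / l2%:R * (- m2%:Z)%:~R :> F.
  move=> /(congr1 (fun n => n%:R : F)); rewrite !natrM => e l10 l20.
  rewrite !mulrNz !mulrN; congr (- _).
  rewrite mulrAC [RHS]mulrAC; apply/eqP; rewrite eqr_div //; apply/eqP.
  by rewrite mulrAC [RHS]mulrAC; exact: esym e.
rewrite /gram /cartan eq_sym; case: eqVneq => [<-//|ne].
rewrite joinedC; case: ifP => [ji|]; last by rewrite !mulr0.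
by apply: swap; rewrite ?pnatr_eq0 -?lt0n ?label_gt0 // multiplicity_sym.
Qed.

Lemma formC u v : form u v = form v u.
Proof.
rewrite /form exchange_big; apply: eq_bigr => i _; apply: eq_bigr => j _.
by rewrite gramC mulrC -[RHS]mulrA [X in _ = _ * X]mulrC.
Qed.

Lemma formDl u1 u2 v : form (u1 + u2) v = form u1 v + form u2 v.
Proof.
rewrite /form -big_split; apply: eq_bigr => i _ /=.
by rewrite -big_split; apply: eq_bigr => j _ /=; rewrite mxE !mulrDl.
Qed.

Lemma formZl a u v : form (a *: u) v = a * form u v.
Proof.
rewrite /form mulr_sumr; apply: eq_bigr => i _ /=.
by rewrite mulr_sumr; apply: eq_bigr => j _ /=; rewrite mxE !mulrA.
Qed.

Lemma formDr u v1 v2 : form u (v1 + v2) = form u v1 + form u v2.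
Proof. by rewrite ![form u _]formC formDl. Qed.

Lemma formZr a u v : form u (a *: v) = a * form u v.
Proof. by rewrite ![form u _]formC formZl. Qed.

Lemma formNl u v : form (- u) v = - form u v.
Proof. by rewrite -scaleN1r formZl mulN1r. Qed.

Lemma formNr u v : form u (- v) = - form u v.
Proof. by rewrite -scaleN1r formZr mulN1r. Qed.

Lemma form0l v : form 0 v = 0.
Proof. by rewrite -(scale0r 0) formZl mul0r. Qed.

Lemma form0r v : form v 0 = 0.
Proof. by rewrite formC form0l. Qed.

Lemma form_suml I (s : seq I) (F : I -> vec X) v :
  form (\sum_(k <- s) F k) v = \sum_(k <- s) form (F k) v.
Proof.
elim/big_rec2: _ => [|k x y _ <-]; first by rewrite form0l.
by rewrite formDl.
Qed.

Lemma formMzl (z : int) u v : form (u *~ z) v = z%:~R * form u v.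
Proof. by rewrite -scaler_int formZl. Qed.

Lemma formMzr (z : int) u v : form u (v *~ z) = z%:~R * form u v.
Proof. by rewrite -scaler_int formZr. Qed.

Lemma form_sl2 (a b a' b' : vec X) (p q r s : int) : p * s - q * r = 1 ->
  form (a' *~ p + b' *~ r) (a *~ q + b *~ s)
    - form (a *~ p + b *~ r) (a' *~ q + b' *~ s) = form a' b - form a b'.
Proof.
move=> /(congr1 (fun z => z%:~R : rat)); rewrite intrB !intrM => e.
rewrite !(formDl, formDr, formMzl, formMzr).
rewrite (formC a' a) (formC b' b) (formC b' a) (formC b a').
rewrite -[RHS]mul1r -[1 in RHS]e; ring.
Qed.

Lemma form_root i j : form (root i) (root j) = gram i j.
Proof.
rewrite /form (bigD1 i) //= [X in _ + X]big1 => [|k /negPf ki]; last first.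
  by rewrite big1 // => l _; rewrite mxE ki !mul0r.
rewrite addr0 (bigD1 j) //= [X in _ + X]big1 => [|k /negPf kj]; last first.
  by rewrite !mxE kj !mulr0.
by rewrite addr0 !mxE !eqxx mul1r mulr1.
Qed.

Lemma gram_diag i :
  gram i i = 2 * ((colabel X i.+1)%:R / (label X i.+1)%:R).
Proof. by rewrite /gram /cartan eqxx mulrC. Qed.

Lemma corootE i :
  coroot i = ((label X i.+1)%:R / (colabel X i.+1)%:R) *: root i.
Proof.
rewrite /coroot form_root gram_diag.
congr (_ *: _); rewrite invfM mulrA divff // mul1r invf_div //.
Qed.

Lemma form_root_coroot i j :
  form (root j) (coroot i) = (cartan X i.+1 j.+1)%:~R.
Proof.
rewrite corootE formZr form_root gramC /gram mulrA.
have l0 k : (label X k)%:R != 0 :> rat by rewrite pnatr_eq0 -lt0n label_gt0.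
have c0 k : (colabel X k)%:R != 0 :> rat.
  by rewrite pnatr_eq0 -lt0n colabel_gt0.
by rewrite mulrA divfK // divff // mul1r.
Qed.

Lemma reflectionE i v :
  reflection i *m v = v - form v (coroot i) *: root i.
Proof.
rewrite mulmxBl mul1mx -mulmxA; congr (_ - _).
set r := (\row__ _); have -> : r *m v = (form v (coroot i))%:M.
  apply/matrixP => a b; rewrite !ord1 !mxE eqxx mulr1n.
  have {2}-> : v = \sum_j v j 0 *: root j.
    apply/matrixP => k l; rewrite summxE (bigD1 k) //= ord1 big1 => [|j ne].
      by rewrite !mxE !eqxx mulr1 addr0.
    by rewrite !mxE eq_sym (negPf ne) mulr0.
  rewrite form_suml; apply: eq_bigr => j _.
  by rewrite mxE formZl mulrC.
by rewrite mul_mx_scalar.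
Qed.

Lemma form_coroot_self i : form (root i) (coroot i) = 2.
Proof. by rewrite form_root_coroot /cartan eqxx. Qed.

Lemma reflection_form i u v :
  form (reflection i *m u) (reflection i *m v) = form u v.
Proof.
have e : coroot i = (2 / gram i i) *: root i by rewrite /coroot form_root.
have g0 : gram i i != 0.
  have := form_coroot_self i; rewrite e formZr form_root.
  by apply: contra_eq_neq => ->; rewrite mulr0 eq_sym pnatr_eq0.
rewrite !reflectionE !e !(formDl, formDr, formNl, formNr, formZl, formZr).
by rewrite form_root (formC (root i) v); field.
Qed.

Lemma reflectionK i : reflection i *m reflection i = 1%:M.
Proof.
apply/matrixP => a b.
have H v : reflection i *m (reflection i *m v) = v.
  rewrite !reflectionE formDl formNl formZl form_coroot_self.
  by rewrite mulr2n mulrDr mulr1 opprD addNKr scaleNr opprK subrK.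
have := congr1 (fun w : vec X => w a 0) (H (root b)).
by rewrite mulmxA /root -colE mxE => ->; rewrite !mxE andbT.
Qed.

(* The Weyl group, generated by the simple reflections; w acts on a column v
   by [w *m v]. *)
Definition weyl_word (s : seq 'I_(rank X)) : 'M[rat]_(rank X) :=
  foldr (fun i w => reflection i *m w) 1%:M s.

Definition weyl_pred : {pred 'M[rat]_(rank X)} := fun w =>
  `[< exists s, w = weyl_word s >].

Lemma weyl_word_cat s t : weyl_word (s ++ t) = weyl_word s *m weyl_word t.
Proof. by elim: s => [|i s IH] /=; rewrite ?mul1mx // IH mulmxA. Qed.

Lemma weyl1 : 1%:M \in weyl_pred.
Proof. by apply/asboolP; exists [::]. Qed.

Lemma weylM : {in weyl_pred &, forall w1 w2, w1 *m w2 \in weyl_pred}.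
Proof.
move=> _ _ /asboolP[s ->] /asboolP[t ->]; apply/asboolP; exists (s ++ t).
by rewrite weyl_word_cat.
Qed.

Lemma weyl_inv w : w \in weyl_pred ->
  w \in unitmx /\ invmx w \in weyl_pred.
Proof.
move=> /asboolP[s ->].
have h : weyl_word s *m weyl_word (rev s) = 1%:M.
  elim: s => [|i s IH] /=; first by rewrite mul1mx.
  rewrite rev_cons -cats1 weyl_word_cat /= mulmx1 mulmxA.
  by rewrite -[_ *m _ *m weyl_word _]mulmxA IH mulmx1 reflectionK.
have [us _] := mulmx1_unit h; split=> //; apply/asboolP; exists (rev s).
by rewrite -[LHS]mulmx1 -h mulKmx.
Qed.

Lemma weyl_form w u v : w \in weyl_pred -> form (w *m u) (w *m v) = form u v.
Proof.
move=> /asboolP[s ->]; elim: s u v => [|i s IH] u v /=; first by rewrite !mul1mx.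
by rewrite -!mulmxA reflection_form.
Qed.

Definition weyl_stable (L : {pred vec X}) :=
  forall w v, w \in weyl_pred -> v \in L -> w *m v \in L.

Definition span_pred (b : 'I_(rank X) -> vec X) : {pred vec X} := fun v =>
  `[< exists c : 'I_(rank X) -> int, v = \sum_i b i *~ c i >].

Fact span_closed b : zmod_closed (span_pred b).
Proof.
split; first by apply/asboolP; exists (fun=> 0); rewrite big1.
move=> _ _ /asboolP[c ->] /asboolP[d ->]; apply/asboolP.
by exists (fun i => c i - d i); rewrite -sumrB; apply: eq_bigr => i _; rewrite -mulrzBr.
Qed.
HB.instance Definition _ b :=
  GRing.isZmodClosed.Build (vec X) (span_pred b) (span_closed b).

Lemma mem_span b i : b i \in span_pred b.
Proof.
apply/asboolP; exists (fun j => (i == j)%:R).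
rewrite (bigD1 i) //= eqxx big1 ?addr0 // => j; rewrite eq_sym => /negPf ->.
by rewrite mulr0z.
Qed.

Definition dual_pred (L : {pred vec X}) : {pred vec X} := fun v =>
  `[< forall u, u \in L -> form v u \is a Num.int >].

Fact dual_closed L : zmod_closed (dual_pred L).
Proof.
split; first by apply/asboolP => u _; rewrite form0l rpred0.
move=> x y /asboolP Lx /asboolP Ly; apply/asboolP => u Lu.
by rewrite formDl formNl rpredB ?Lx ?Ly.
Qed.
HB.instance Definition _ L :=
  GRing.isZmodClosed.Build (vec X) (dual_pred L) (dual_closed L).

Definition root_lattice : zmodClosed (vec X) := span_pred root.

Definition coroot_lattice : zmodClosed (vec X) := span_pred coroot.

Definition weight_lattice : zmodClosed (vec X) := dual_pred coroot_lattice.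

Definition M_lattice : zmodClosed (vec X) :=
  if (tier X <= label X 0)%N then coroot_lattice else root_lattice.

Definition M_dual : zmodClosed (vec X) := dual_pred M_lattice.

(* m <M_dual, weight_lattice> is contained in Z *)
Definition clears_pairing (m : nat) : Prop :=
  forall b a, b \in M_dual -> a \in weight_lattice ->
    m%:R * form b a \is a Num.int.

Record denominator := Denominator {
  denom :> nat;
  denom_gt0 : (0 < denom)%N;
  denomP : clears_pairing denom;
  denom_least : forall m, (0 < m)%N -> clears_pairing m -> (denom <= m)%N
}.

Lemma span_stable b :
  (forall i j, reflection i *m b j \in span_pred b) -> weyl_stable (span_pred b).
Proof.
move=> sb w v /asboolP[s ->]; elim: s v => [|i s IH] v Lv /=.
  by rewrite mul1mx.
rewrite -mulmxA; have /asboolP[c ->] := IH v Lv.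
rewrite mulmx_sumr rpred_sum // => j _.
by rewrite (raddfMz (mulmx (reflection i))) rpredMz // sb.
Qed.

Lemma dual_stable (L : {pred vec X}) : weyl_stable L -> weyl_stable (dual_pred L).
Proof.
move=> sL w v Ww /asboolP Lv; apply/asboolP => u Lu.
have [uw Wi] := weyl_inv Ww.
by rewrite -(mulKVmx uw u) weyl_form // Lv // sL.
Qed.

Lemma root_stable : weyl_stable root_lattice.
Proof.
apply: span_stable => i j; rewrite reflectionE form_root_coroot scaler_int.
by rewrite rpredB ?rpredMz ?mem_span.
Qed.

Lemma coroot_stable : weyl_stable coroot_lattice.
Proof.
apply: span_stable => i j; rewrite reflectionE.
have -> : form (coroot j) (coroot i) *: root i
        = form (root i) (coroot j) *: coroot i.
  by rewrite (corootE i) formZr (formC (root i)) scalerA mulrC.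
by rewrite form_root_coroot scaler_int rpredB ?rpredMz ?mem_span.
Qed.

Lemma weight_stable : weyl_stable weight_lattice.
Proof. exact/dual_stable/coroot_stable. Qed.

Lemma M_stable : weyl_stable M_lattice.
Proof.
by rewrite /M_lattice; case: ifP => _; [apply: coroot_stable|apply: root_stable].
Qed.

Lemma M_dual_stable : weyl_stable M_dual.
Proof. exact/dual_stable/M_stable. Qed.

Lemma dual_spanP b v :
  reflect (forall i, form v (b i) \is a Num.int) (v \in dual_pred (span_pred b)).
Proof.
apply: (iffP idP) => [/asboolP H i|H]; first exact/H/mem_span.
apply/asboolP => u /asboolP[c ->].
rewrite formC form_suml rpred_sum // => i _.
by rewrite formMzl rpredM ?intr_int // formC.
Qed.

Lemma weight_sub_M_dual v : v \in weight_lattice -> v \in M_dual.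
Proof.
rewrite /M_dual /M_lattice; case: ifPn => // twisted /dual_spanP Pv.
apply/dual_spanP => i; have /andP[/dvdnP[q e] _] := label_dvd twisted (ltn0Sn i).
have := Pv i; rewrite corootE formZr e natrM => Pi.
have q0 : q%:R != 0 :> rat.
  by rewrite pnatr_eq0 -lt0n; have := colabel_gt0 X i.+1; rewrite e; case: (q).
have l0 : (label X i.+1)%:R != 0 :> rat by rewrite pnatr_eq0 -lt0n label_gt0.
set a := form _ _ in Pi *; set b := label _ _ in l0 Pi.
have -> : a = q%:R * (b%:R / (q%:R * b%:R) * a) by field; rewrite l0 q0.
by rewrite rpredM ?natr_int.
Qed.

Lemma tier_M_dual_sub_weight v :
  v \in M_dual -> v *~ (tier X)%:Z \in weight_lattice.
Proof.
rewrite /M_dual /M_lattice; case: ifPn => [_|twisted /dual_spanP Mv].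
  by move=> /(rpredMz _); apply.
apply/dual_spanP => i; have /andP[_ /dvdnP[q e]] := label_dvd twisted (ltn0Sn i).
rewrite formMzl corootE formZr.
have c0 : (colabel X i.+1)%:R != 0 :> rat by rewrite pnatr_eq0 -lt0n colabel_gt0.
have e' : (tier X)%:R * (label X i.+1)%:R = q%:R * (colabel X i.+1)%:R :> rat.
  by rewrite -!natrM e.
rewrite -pmulrn 2!mulrA e' mulfK //.
by rewrite rpredM ?natr_int ?Mv.
Qed.

End FiniteRootSystem.

(* A subgroup L of an additive group, as an additive group of its own. *)
Inductive lattice (V : zmodType) (L : zmodClosed V) : Type :=
  Lattice (x : V) of x \in L.

Definition lattice_val (V : zmodType) (L : zmodClosed V) (x : lattice L) : V :=
  let: Lattice v _ := x in v.
Coercion lattice_val : lattice >-> GRing.Zmodule.sort.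

Section LatticeInstances.
Variables (V : zmodType) (L : zmodClosed V).
HB.instance Definition _ := [isSub for @lattice_val V L].
HB.instance Definition _ := [Choice of lattice L by <:].
HB.instance Definition _ := [SubChoice_isSubZmodule of lattice L by <:].
End LatticeInstances.

(* The semidirect product of G and H for a right action of G on H by group
   automorphisms: (g, x) stands for the product g x, and g^-1 x g = x . g. *)
Record right_action (G H : groupType) := RightAction {
  ract :> H -> G -> H;
  ract1 : forall x, ract x 1%g = x;
  ractM : forall x g h, ract x (g * h)%g = ract (ract x g) h;
  ractMl : forall x y g, ract (x * y)%g g = (ract x g * ract y g)%g
}.

Definition semidirect (G H : groupType) (a : right_action G H) : Type :=
  (G * H)%type.

Section Semidirect.
Variables (G H : groupType) (a : right_action G H).

HB.instance Definition _ := Choice.on (semidirect a).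

Definition semidirect_mul (x y : semidirect a) : semidirect a :=
  ((x.1 * y.1)%g, (a x.2 y.1 * y.2)%g).

Definition semidirect_inv (x : semidirect a) : semidirect a :=
  ((x.1^-1)%g, (a x.2 x.1^-1)^-1%g).

Let ract1g g : a 1%g g = 1%g.
Proof. by apply: (mulgI (a 1%g g)); rewrite -ractMl !mulg1. Qed.

Let ractV x g : a (x^-1)%g g = ((a x g)^-1)%g.
Proof. by apply: (mulgI (a x g)); rewrite -ractMl !mulgV ract1g. Qed.

Fact semidirect_mulA : associative semidirect_mul.
Proof.
by move=> x y z; rewrite /semidirect_mul /= ractMl ractM !mulgA.
Qed.

Fact semidirect_mul1 : left_id ((1, 1)%g : semidirect a) semidirect_mul.
Proof. by case=> g x; rewrite /semidirect_mul /= ract1g !mul1g. Qed.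

Fact semidirect_mul1r : right_id ((1, 1)%g : semidirect a) semidirect_mul.
Proof. by case=> g x; rewrite /semidirect_mul /= ract1 !mulg1. Qed.

Fact semidirect_mulV :
  left_inverse ((1, 1)%g : semidirect a) semidirect_inv semidirect_mul.
Proof.
case=> g x; rewrite /semidirect_mul /semidirect_inv /= mulVg.
by rewrite ractV -ractM mulVg ract1 mulVg.
Qed.

Fact semidirect_mulVr :
  right_inverse ((1, 1)%g : semidirect a) semidirect_inv semidirect_mul.
Proof.
by case=> g x; rewrite /semidirect_mul /semidirect_inv /= !mulgV.
Qed.

HB.instance Definition _ := isGroup.Build (semidirect a)
  semidirect_mulA semidirect_mul1 semidirect_mul1r
  semidirect_mulV semidirect_mulVr.

End Semidirect.

Section WeylGroup.
Variable X : affine_type.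

Inductive weyl_group : Type := Weyl w of w \in @weyl_pred X.

Definition weyl_mx (w : weyl_group) : 'M[rat]_(rank X) := let: Weyl m _ := w in m.
HB.instance Definition _ := [isSub for weyl_mx].
HB.instance Definition _ := [Choice of weyl_group by <:].

Definition weyl_one : weyl_group := Weyl (weyl1 X).
Definition weyl_mul (w1 w2 : weyl_group) : weyl_group :=
  Weyl (weylM (valP w1) (valP w2)).
Definition weyl_group_inv (w : weyl_group) : weyl_group :=
  Weyl (proj2 (weyl_inv (valP w))).

Fact weyl_mulA : associative weyl_mul.
Proof. by move=> x y z; apply: val_inj; rewrite /= mulmxA. Qed.
Fact weyl_mul1 : left_id weyl_one weyl_mul.
Proof. by move=> x; apply: val_inj; rewrite /= mul1mx. Qed.
Fact weyl_mul1r : right_id weyl_one weyl_mul.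
Proof. by move=> x; apply: val_inj; rewrite /= mulmx1. Qed.
Fact weyl_mulV : left_inverse weyl_one weyl_group_inv weyl_mul.
Proof.
by move=> x; apply: val_inj; rewrite /= mulVmx // (proj1 (weyl_inv (valP x))).
Qed.
Fact weyl_mulVr : right_inverse weyl_one weyl_group_inv weyl_mul.
Proof.
by move=> x; apply: val_inj; rewrite /= mulmxV // (proj1 (weyl_inv (valP x))).
Qed.
HB.instance Definition _ := isGroup.Build weyl_group
  weyl_mulA weyl_mul1 weyl_mul1r weyl_mulV weyl_mulVr.

Definition weyl_act (L : zmodClosed (vec X)) (sL : weyl_stable L)
    (w : weyl_group) (v : lattice L) : lattice L :=
  Lattice (sL _ _ (valP w) (valP v)).

End WeylGroup.

Section CongruenceSubgroup.
Variable r : nat.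

Definition Gamma1_pred : {pred 'M[int]_2} := fun g =>
  [&& \det g == 1, (r %| (g 0 0 - 1)%R)%Z, (r %| (g 1 0)%R)%Z
    & (r %| (g 1 1 - 1)%R)%Z].

Inductive Gamma1 : Type := GammaMx g of g \in Gamma1_pred.

Definition Gamma1_mx (g : Gamma1) : 'M[int]_2 := let: GammaMx m _ := g in m.
Coercion Gamma1_mx : Gamma1 >-> matrix.
HB.instance Definition _ := [isSub for Gamma1_mx].
HB.instance Definition _ := [Choice of Gamma1 by <:].

Fact Gamma1_1 : 1%:M \in Gamma1_pred.
Proof. by rewrite unfold_in det1 !mxE /= !subrr !dvdz0. Qed.

Let ord2 : lift ord0 ord0 = 1 :> 'I_2. Proof. by apply/eqP. Qed.

Fact Gamma1_M : {in Gamma1_pred &, forall g h, g *m h \in Gamma1_pred}.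
Proof.
move=> g h /and4P[/eqP dg ga gc gd] /and4P[/eqP dh ha hc hd].
have E i j : (g *m h) i j = g i 0 * h 0 j + g i 1 * h 1 j.
  by rewrite mxE !big_ord_recl big_ord0 addr0 ord2.
rewrite unfold_in det_mulmx dg dh mulr1 eqxx !E /=; apply/and3P; split.
- have -> : g 0 0 * h 0 0 + g 0 1 * h 1 0 - 1
          = (g 0 0 - 1) * h 0 0 + (h 0 0 - 1) + g 0 1 * h 1 0 by ring.
  by apply/rpredD/dvdz_mull => //; apply/rpredD => //; apply: dvdz_mulr.
- by apply: rpredD; [apply: dvdz_mulr|apply: dvdz_mull].
- have -> : g 1 0 * h 0 1 + g 1 1 * h 1 1 - 1
          = g 1 0 * h 0 1 + ((g 1 1 - 1) * h 1 1 + (h 1 1 - 1)) by ring.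
  by apply/rpredD/rpredD => //; apply: dvdz_mulr.
Qed.

Fact Gamma1_V g : g \in Gamma1_pred ->
  g \in unitmx /\ invmx g \in Gamma1_pred.
Proof.
move=> /and4P[/eqP dg ga gc gd].
have ug : g \in unitmx by rewrite unitmxE dg unitr1.
have l00 : lift (0 : 'I_2) ord0 = 1 by apply/eqP.
have l10 : lift (1 : 'I_2) ord0 = 0 by apply/eqP.
split=> //; rewrite unfold_in det_inv dg invr1 eqxx /=.
rewrite /invmx ug dg invr1 scale1r.
have C i j : (\adj g) i j = (-1) ^+ (j + i) * g (lift j ord0) (lift i ord0).
  by rewrite mxE /cofactor det_mx11 !mxE.
rewrite !C !l00 !l10 /= addn0 add0n expr0 expr1 sqrrN expr1n !mul1r mulN1r.
by rewrite rpredN; apply/and3P.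
Qed.

Fact Gamma1_det (g : Gamma1) : g 0 0 * g 1 1 - g 0 1 * g 1 0 = 1.
Proof.
have /and4P[/eqP dg _ _ _] := valP g; rewrite -[RHS]dg.
have l10 : lift (1 : 'I_2) ord0 = 0 by apply/eqP.
rewrite (expand_det_row _ 0) !big_ord_recl big_ord0 addr0 /cofactor.
by rewrite !det_mx11 !mxE /= !ord2 l10 !expr1 expr0 mul1r mulN1r mulrN.
Qed.

Definition Gamma1_one : Gamma1 := GammaMx Gamma1_1.
Definition Gamma1_mul (g h : Gamma1) : Gamma1 :=
  GammaMx (Gamma1_M (valP g) (valP h)).
Definition Gamma1_inv (g : Gamma1) : Gamma1 :=
  GammaMx (proj2 (Gamma1_V (valP g))).

Fact Gamma1_mulA : associative Gamma1_mul.
Proof. by move=> x y z; apply: val_inj; rewrite /= mulmxA. Qed.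
Fact Gamma1_mul1 : left_id Gamma1_one Gamma1_mul.
Proof. by move=> x; apply: val_inj; rewrite /= mul1mx. Qed.
Fact Gamma1_mul1r : right_id Gamma1_one Gamma1_mul.
Proof. by move=> x; apply: val_inj; rewrite /= mulmx1. Qed.
Fact Gamma1_mulV : left_inverse Gamma1_one Gamma1_inv Gamma1_mul.
Proof.
by move=> x; apply: val_inj; rewrite /= mulVmx // (proj1 (Gamma1_V (valP x))).
Qed.
Fact Gamma1_mulVr : right_inverse Gamma1_one Gamma1_inv Gamma1_mul.
Proof.
by move=> x; apply: val_inj; rewrite /= mulmxV // (proj1 (Gamma1_V (valP x))).
Qed.
HB.instance Definition _ := isGroup.Build Gamma1
  Gamma1_mulA Gamma1_mul1 Gamma1_mul1r Gamma1_mulV Gamma1_mulVr.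

End CongruenceSubgroup.

Section HeisenbergGroup.
Variables (X : affine_type) (m : denominator X).

Local Notation P := (weight_lattice X).
Local Notation Mo := (M_dual X).

(* The central coordinate u ranges over (1/2m)Z: the products of the triples
   with u in (1/m)Z involve <alpha, beta>/2, so that this is the group which
   those triples generate. *)
Definition center_pred : {pred rat} := fun u =>
  (2 * m)%:R * u \is a Num.int.

Fact center_closed : zmod_closed center_pred.
Proof.
split=> [|u v]; first by rewrite unfold_in mulr0.
by rewrite !unfold_in mulrBr; apply: rpredB.
Qed.
HB.instance Definition _ :=
  GRing.isZmodClosed.Build rat center_pred center_closed.

Definition center : zmodClosed rat := center_pred.

Record heis := Heis {
  heis_t : lattice P;
  heis_p : lattice Mo;
  heis_u : lattice center
}.

Definition heis_tuple (x : heis) := (heis_t x, heis_p x, heis_u x).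
Definition tuple_heis (x : lattice P * lattice Mo * lattice center) : heis :=
  Heis x.1.1 x.1.2 x.2.
Fact heis_tupleK : cancel heis_tuple tuple_heis. Proof. by case. Qed.
HB.instance Definition _ := Choice.copy heis (can_type heis_tupleK).

Fact half_subproof (a : lattice P) (b : lattice Mo) :
  form (val a) (val b) / 2 \in center.
Proof.
rewrite unfold_in /= natrM -mulrA mulrCA.
rewrite (_ : 2%:R * _ = form (val b) (val a)); last first.
  by rewrite mulrC divfK // formC.
by apply: denomP; apply: valP.
Qed.

Definition half (a : lattice P) (b : lattice Mo) : lattice center :=
  Lattice (half_subproof a b).

Fact half0l b : half 0 b = 0.
Proof. by apply: val_inj; rewrite /= form0l mul0r. Qed.
Fact half0r a : half a 0 = 0.
Proof. by apply: val_inj; rewrite /= form0r mul0r. Qed.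
Fact halfDl a1 a2 b : half (a1 + a2) b = half a1 b + half a2 b.
Proof. by apply: val_inj; rewrite /= formDl mulrDl. Qed.
Fact halfDr a b1 b2 : half a (b1 + b2) = half a b1 + half a b2.
Proof. by apply: val_inj; rewrite /= formDr mulrDl. Qed.
Fact halfNl a b : half (- a) b = - half a b.
Proof. by apply: val_inj; rewrite /= formNl mulNr. Qed.
Fact halfNr a b : half a (- b) = - half a b.
Proof. by apply: val_inj; rewrite /= formNr mulNr. Qed.

Definition heis_mul (x y : heis) : heis :=
  Heis (heis_t x + heis_t y) (heis_p x + heis_p y)
       (heis_u x + heis_u y + half (heis_t y) (heis_p x)
                            - half (heis_t x) (heis_p y)).

Definition heis_one : heis := Heis 0 0 0.

Definition heis_inv (x : heis) : heis :=
  Heis (- heis_t x) (- heis_p x) (- heis_u x).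

Fact heis_mulA : associative heis_mul.
Proof.
case=> a b u [a' b' u'] [a'' b'' u'']; rewrite /heis_mul /= !addrA.
congr Heis; rewrite !halfDl !halfDr.
by apply: val_inj; rewrite /=; ring.
Qed.

Fact heis_mul1 : left_id heis_one heis_mul.
Proof.
by case=> a b u; rewrite /heis_mul /= !add0r half0l half0r addr0 subr0.
Qed.

Fact heis_mul1r : right_id heis_one heis_mul.
Proof.
by case=> a b u; rewrite /heis_mul /= !addr0 half0l half0r addr0 subr0.
Qed.

Fact heis_mulV : left_inverse heis_one heis_inv heis_mul.
Proof.
case=> a b u; rewrite /heis_mul /heis_one /= !addNr halfNl halfNr.
by rewrite add0r opprK addNr.
Qed.

Fact heis_mulVr : right_inverse heis_one heis_inv heis_mul.
Proof.
case=> a b u; rewrite /heis_mul /heis_one /= !addrN halfNl halfNr.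
by rewrite add0r opprK addNr.
Qed.

HB.instance Definition _ := isGroup.Build heis
  heis_mulA heis_mul1 heis_mul1r heis_mulV heis_mulVr.

(* The action of the Weyl group, made a right action. *)
Definition heis_weyl (x : heis) (w : weyl_group X) : heis :=
  Heis (weyl_act (@weight_stable X) w^-1%g (heis_t x))
       (weyl_act (@M_dual_stable X) w^-1%g (heis_p x)) (heis_u x).

Fact weyl_act1 (L : zmodClosed (vec X)) (sL : weyl_stable L) v :
  weyl_act sL 1%g v = v.
Proof. by apply: val_inj; rewrite /= mul1mx. Qed.

Fact weyl_actM (L : zmodClosed (vec X)) (sL : weyl_stable L) w1 w2 v :
  weyl_act sL (w1 * w2)%g v = weyl_act sL w1 (weyl_act sL w2 v).
Proof. by apply: val_inj; rewrite /= -mulmxA. Qed.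

Fact weyl_actD (L : zmodClosed (vec X)) (sL : weyl_stable L) w v1 v2 :
  weyl_act sL w (v1 + v2) = weyl_act sL w v1 + weyl_act sL w v2.
Proof. by apply: val_inj; rewrite /= mulmxDr. Qed.

Fact half_weyl w a b :
  half (weyl_act (@weight_stable X) w a) (weyl_act (@M_dual_stable X) w b)
  = half a b.
Proof. by apply: val_inj; rewrite /= (weyl_form _ _ (valP w)). Qed.

Fact heis_weyl1 x : heis_weyl x 1%g = x.
Proof. by case: x => a b u; rewrite /heis_weyl /= invg1 !weyl_act1. Qed.

Fact heis_weylM x w1 w2 :
  heis_weyl x (w1 * w2)%g = heis_weyl (heis_weyl x w1) w2.
Proof. by rewrite /heis_weyl /= invgM !weyl_actM. Qed.

Fact heis_weylMl x y w :
  heis_weyl (x * y)%g w = (heis_weyl x w * heis_weyl y w)%g.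
Proof. by rewrite /heis_weyl /= !weyl_actD; congr Heis; rewrite /= !half_weyl. Qed.

Definition heis_weyl_action : right_action (weyl_group X) heis :=
  RightAction heis_weyl1 heis_weylM heis_weylMl.

(* The extended double affine Weyl group. *)
Definition double_affine_weyl : groupType := semidirect heis_weyl_action.

Local Notation Gamma := (Gamma1 (tier X)).

Fact gamma_t_subproof (a : lattice P) (b : lattice Mo) (g : Gamma) :
  val a *~ (g : 'M_2) 0 0 + val b *~ (g : 'M_2) 1 0 \in P.
Proof.
apply: rpredD; first exact/rpredMz/valP.
have /and4P[_ _ /dvdzP[q e] _] := valP g.
by rewrite (e : (g : 'M_2) 1 0 = _) mulrC mulrzA rpredMz // tier_M_dual_sub_weight // (valP b).
Qed.

Fact gamma_p_subproof (a : lattice P) (b : lattice Mo) (g : Gamma) :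
  val a *~ (g : 'M_2) 0 1 + val b *~ (g : 'M_2) 1 1 \in Mo.
Proof.
apply: rpredD; last exact/rpredMz/valP.
by apply/rpredMz/weight_sub_M_dual/valP.
Qed.

Definition heis_gamma (x : heis) (g : Gamma) : heis :=
  Heis (Lattice (gamma_t_subproof (heis_t x) (heis_p x) g))
       (Lattice (gamma_p_subproof (heis_t x) (heis_p x) g)) (heis_u x).

Fact heis_ext (x y : heis) :
  val (heis_t x) = val (heis_t y) -> val (heis_p x) = val (heis_p y) ->
  heis_u x = heis_u y -> x = y.
Proof. by case: x y => a b u [a' b' u'] /= /val_inj-> /val_inj-> ->. Qed.

Fact heis_gamma1 x : heis_gamma x 1%g = x.
Proof.
by apply: heis_ext => //=; rewrite !mxE /= mulr1z mulr0z ?addr0 ?add0r.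
Qed.

Fact heis_gammaM x g h :
  heis_gamma x (g * h)%g = heis_gamma (heis_gamma x g) h.
Proof.
have E i j : (val g *m val h) i j
    = (val g) i 0 * (val h) 0 j + (val g) i 1 * (val h) 1 j.
  rewrite mxE !big_ord_recl big_ord0 addr0.
  by rewrite (_ : lift ord0 ord0 = 1) //; apply/eqP.
apply: heis_ext => //=; rewrite !E !mulrzDl !mulrzDr !mulrzA.
  by rewrite addrACA.
by rewrite addrACA.
Qed.

Fact heis_gammaMl x y g :
  heis_gamma (x * y)%g g = (heis_gamma x g * heis_gamma y g)%g.
Proof.
apply: heis_ext => /=; try by rewrite !mulrzDl addrACA.
apply: val_inj => /=; rewrite -!addrA; congr (_ + (_ + _)).
by rewrite -!mulrBl form_sl2 // Gamma1_det.
Qed.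

Definition heis_gamma_action : right_action Gamma heis :=
  RightAction heis_gamma1 heis_gammaM heis_gammaMl.

Definition weyl_gamma (x : double_affine_weyl) (g : Gamma) :
  double_affine_weyl := (x.1, heis_gamma x.2 g).

Fact weyl_gamma1 x : weyl_gamma x 1%g = x.
Proof. by case: x => w h; rewrite /weyl_gamma heis_gamma1. Qed.

Fact weyl_gammaM x g h : weyl_gamma x (g * h)%g = weyl_gamma (weyl_gamma x g) h.
Proof. by rewrite /weyl_gamma heis_gammaM. Qed.

Fact weyl_gammaMl x y g :
  weyl_gamma (x * y)%g g = (weyl_gamma x g * weyl_gamma y g)%g.
Proof.
case: x y => [w h] [w' h']; congr (_, _); rewrite /= heis_gammaMl.
congr (_ * _)%g; apply: heis_ext => //=;
  by rewrite mulmxDr !(raddfMz (mulmx (invmx _))).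
Qed.

Definition weyl_gamma_action : right_action Gamma double_affine_weyl :=
  RightAction weyl_gamma1 weyl_gammaM weyl_gammaMl.

Definition gamma_double_affine_weyl : groupType :=
  semidirect weyl_gamma_action.

Definition gamma_elt (g : Gamma) : gamma_double_affine_weyl := (g, 1%g).

Definition affine_elt (x : double_affine_weyl) : gamma_double_affine_weyl :=
  (1%g, x).

Definition weyl_elt (w : weyl_group X) : double_affine_weyl := (w, 1%g).

End HeisenbergGroup.

Definition level (X : affine_type) (l : nat) : nat := (l + dual_coxeter X)%N.

Definition level_scaled (X : affine_type) (k : nat) (L : {pred vec X}) (v : vec X)
  : Prop := exists2 u, u \in L & v = u *+ k.

(* The normal subgroup (l + h^vee)M . (l + h^vee)Q^vee, by which the double
   affine Weyl group is divided to obtain the finite one.  Its elements are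
   t_a p_b p_(z delta) = (a, b, z - <a, b>/2) with a, b and z in l + h^vee times
   M, the coroot lattice and Z.  Gamma_1(r) preserves it except in the case of
   A_2l^(2) with odd l + h^vee, where (a, b, u) can be moved to an element that
   acts by -1 on the truncated polynomials; the semidirect product with
   Gamma_1(r) is therefore formed before dividing, and a representation of the
   finite group is one that is trivial on this subgroup. *)
Definition level_subgroup (X : affine_type) (m : denominator X) (l : nat)
    (x : double_affine_weyl m) : Prop :=
  let a := val (heis_t x.2) in let b := val (heis_p x.2) in
  [/\ x.1 = 1%g,
      level_scaled (level X l) (M_lattice X) a,
      level_scaled (level X l) (coroot_lattice X) b
    & exists z : int, val (heis_u x.2) + form a b / 2 = z%:~R *+ level X l].

Section TruncatedPolynomials.
Variables (R : realType) (X : affine_type) (l : nat).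

Local Notation P := (lattice (weight_lattice X)).
Local Notation Mo := (lattice (M_dual X)).
Local Notation k := (level X l).

Definition level_M_pred : {pred P} := fun a =>
  `[< level_scaled k (M_lattice X) (val a) >].

Fact level_M_closed : zmod_closed level_M_pred.
Proof.
split; first by apply/asboolP; exists 0; rewrite ?rpred0 // mul0rn.
move=> a b /asboolP[u Mu eu] /asboolP[v Mv ev]; apply/asboolP.
by exists (u - v); rewrite ?rpredB // mulrnBl -eu -ev.
Qed.
HB.instance Definition _ :=
  GRing.isZmodClosed.Build P level_M_pred level_M_closed.

(* G_l = P / (l + h^vee)M *)
Definition level_group : zmodType := {ideal_quot level_M_pred}.

Definition level_class (a : P) : level_group := \pi_({ideal_quot level_M_pred})%qT a.

Definition level_repr (x : level_group) : P := repr (x : {ideal_quot level_M_pred}).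

(* C[G_l], as the space of functions on the finite group G_l; e^a is the
   indicator function of the class of a. *)
Definition trunc_poly : lmodType R[i] := (level_group -> R[i]^o)%type.

Definition expo (a : P) : trunc_poly := fun x => (x == level_class a)%:R.

(* e^(2 pi i u / (l + h^vee)) *)
Definition phase (u : rat) : R[i] :=
  let t : R := 2 * pi * ratr u / k%:R in (cos t +i* sin t)%C.

Definition op_t (a : P) (f : trunc_poly) : trunc_poly :=
  fun x => f (x - level_class a).

Definition op_p (b : Mo) (f : trunc_poly) : trunc_poly :=
  fun x => phase (form (val b) (val (level_repr x))) * f x.

Definition op_u (u : rat) (f : trunc_poly) : trunc_poly := phase u *: f.

Definition op_w (w : weyl_group X) (f : trunc_poly) : trunc_poly :=
  fun x => f (level_class (weyl_act (@weight_stable X) w^-1%g (level_repr x))).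

(* The operator of w (alpha, beta, u) = w t_alpha p_beta p_(u + <alpha,beta>/2) *)
Definition trunc_rep (m : denominator X) (x : double_affine_weyl m)
    (f : trunc_poly) : trunc_poly :=
  let: (w, h) := x in
  op_w w (op_t (heis_t h) (op_p (heis_p h)
    (op_u (val (heis_u h) + form (val (heis_t h)) (val (heis_p h)) / 2) f))).

Lemma level_reprK x : level_class (level_repr x) = x.
Proof. exact: reprK. Qed.

Lemma level_classB a b : level_class (a - b) = level_class a - level_class b.
Proof. exact: (raddfB (\pi_({ideal_quot level_M_pred})%qT)). Qed.

Lemma level_classP a b :
  (level_class a == level_class b) = (a - b \in level_M_pred).
Proof. by rewrite Quotient.idealrBE. Qed.

Lemma phaseD u v : phase (u + v) = phase u * phase v.
Proof.
rewrite /phase raddfD /= mulrDr mulrDl cosD sinD.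
by congr (_ +i* _)%C; rewrite addrC.
Qed.

Lemma phase0 : phase 0 = 1.
Proof. by rewrite /phase raddf0 mulr0 mul0r cos0 sin0. Qed.

Lemma phase_level (z : int) : phase (z%:~R *+ k) = 1.
Proof.
have [->|k0] := eqVneq k 0%N; first by rewrite mulr0n phase0.
have e1 : phase (1 *+ k) = 1.
  rewrite /phase ratr_nat mulfK ?pnatr_eq0 // mulr_natl.
  by rewrite cos2pi sin2pi.
have en n : phase (n%:R *+ k) = 1.
  elim: n => [|n IH]; first by rewrite mul0rn phase0.
  by rewrite -addn1 natrD mulrnDl phaseD IH e1 mulr1.
case: z => n; first exact: en.
rewrite NegzE mulrNz mulNrn.
by rewrite -[LHS]mulr1 -(en n.+1) -phaseD addNr phase0.
Qed.

Lemma op_t_expo a b : op_t a (expo b) = expo (b + a).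
Proof.
apply/funext => x; rewrite /op_t /expo -[x]level_reprK -level_classB.
by rewrite !level_classP opprD addrA addrAC.
Qed.

Lemma op_p_expo b a : op_p b (expo a) = phase (form (val b) (val a)) *: expo a.
Proof.
apply/funext => x.
suff: phase (form (val b) (val (level_repr x))) * (x == level_class a)%:R
    = phase (form (val b) (val a)) * (x == level_class a)%:R by [].
have [e|_] := eqVneq x (level_class a); last by rewrite !mulr0.
congr (_ * _); have /eqP := level_reprK x; rewrite e level_classP.
move=> /asboolP[v Mv] ev; move: (level_repr _) ev => c ev.
have -> : val c = val a + v *+ k by rewrite -ev addrC subrK.
rewrite formDr phaseD -scaler_nat formZr mulr_natl.
have /intrP[z ->] : form (val b) v \is a Num.int by exact: (asboolW (valP b)).
by rewrite phase_level mulr1.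
Qed.

Lemma level_M_weyl w a : a \in level_M_pred ->
  weyl_act (@weight_stable X) w a \in level_M_pred.
Proof.
move=> /asboolP[v Mv e]; apply/asboolP; exists (val w *m v).
  by apply: M_stable => //; apply: valP.
by rewrite /= e (raddfMn (mulmx _)).
Qed.

Lemma op_w_expo w a :
  op_w w (expo a) = expo (weyl_act (@weight_stable X) w a).
Proof.
apply/funext => x; rewrite /op_w /expo -[x in RHS]level_reprK !level_classP.
set y := level_repr x; congr (nat_of_bool _)%:R.
have N w' v : weyl_act (@weight_stable X) w' (- v)
            = - weyl_act (@weight_stable X) w' v.
  by apply: val_inj; rewrite /= mulmxN.
apply/idP/idP => [/(level_M_weyl w)|/(level_M_weyl w^-1%g)].
  by rewrite weyl_actD N -weyl_actM mulgV weyl_act1.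
by rewrite weyl_actD N -weyl_actM mulVg weyl_act1.
Qed.

End TruncatedPolynomials.

(* A projective representation, as a lift of a homomorphism to PGL(V): linear
   automorphisms multiplicative up to non-zero scalars. *)
Definition projective_representation (F : fieldType) (V : lmodType F)
    (G : groupType) (rho : G -> {linear V -> V}) : Prop :=
  (forall g, bijective (rho g)) /\
  exists2 c : G -> G -> F, (forall g h, c g h != 0) &
    forall g h v, rho g (rho h v) = c g h *: rho (g * h)%g v.

(* Main.v *)
From HB Require Import structures.
From mathcomp Require Import all_boot all_order all_algebra.
From mathcomp Require Import zify ring lra.
From mathcomp Require Import complex boolp reals trigo functions.
Require Import Defs.

Set Implicit Arguments.
Unset Strict Implicit.
Unset Printing Implicit Defensive.

Import Order.TTheory GRing.Theory Num.Theory.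
Local Open Scope ring_scope.

(** Put k = l + h^vee and G = P/kM, where P is the weight lattice.  An element
    h = (alpha, beta, u) of the Heisenberg group acts on functions on G by an
    operator T(h), a translation by alpha times the character <beta, .> times a
    phase.  For each g in Gamma_1(r) the proof produces an invertible operator
    A_g on C[G] that commutes with the finite Weyl group and satisfies

      A_g T(h . g) = chi_g(h) T(h) A_g,     chi_g a character with values +-1.

    Such an A_g is unique up to a scalar.  Indeed M^o separates the points of G,
    because the double dual of M is M; hence an operator which commutes with all
    T(h) maps the delta function at 0 to a multiple of itself, and it is a scalar
    because the translates of that delta function span C[G] ([commutant_scalar]).
    The characters satisfy chi_(g g')(h) = chi_g(h) chi_g'(h . g)
    ([twist_cocycle]), so that A_g A_g' and A_(g g') intertwine the same actions
    and are proportional ([intertwiner_unique]).  Then g x |-> A_g T(x) is a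
    projective representation of the semidirect product.

    For existence, r <= 3, so that the Euclidean algorithm shows that Gamma_1(r)
    is generated by the matrices with rows (1, n), (0, 1), those with rows (1, 0),
    (r n, 1), and -1 when r divides 2 ([Gamma1_ind]).
    - For an upper unipotent matrix, A_g multiplies by a Gaussian, the phase of
      -n <lambda, lambda>/2 ([intertwiner_upper]).
    - The group dual to G is B = M^o/kQ^vee, with the pairing given by the phase
      of <beta, lambda>.  The Fourier transform carries translations on G to
      multiplications on B and conversely, so for a lower unipotent matrix A_g is
      the conjugate by it of the multiplication by the phase of
      n r <beta, beta>/2 on B ([intertwiner_lower]).
    - The matrix -1 acts by f(-x).
    All these operators commute with the Weyl group because the form is invariant.

    The Gaussian on B is well defined since r <mu, mu>/2 is an integer for mu in
    Q^vee.  The Gaussian on G is well defined as soon as k <mu, mu>/2 is an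
    integer for mu in M, which can fail only in type A_2n^(2) with k odd.  In that
    type P = M = M^o is an odd unimodular lattice; replacing <lambda, lambda>/2 by
    (k + 1) <lambda, lambda>/2 restores periodicity, at the price of the character
    chi_g(h) = (-1)^(g_01 <alpha, alpha>).  In all other cases chi_g = 1.

    Finiteness of G and B, and the equality of M with its double dual, rest on the
    nondegeneracy of the form ([form_nondegenerate]). *)

(** * Nondegeneracy of the invariant form *)

(** A positive vector on the nodes 1, ..., n whose image under the finite Cartan
    matrix is positive.  For the exceptional types it lists the coordinates of the
    sum of the positive roots; along the chains of the classical types it is a
    concave parabola, halved at an end node n with a_(n-1,n) = -2 and at the two
    end nodes of a fork. *)
Definition height (X : affine_type) (i : nat) : nat :=
  match X with
  | A1 p => i * (p.+2 - i)
  | B1 p => i * (2 * p.+3 - i)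
  | D2 p => i * (2 * p.+2 - i)
  | C1 p => if i == p.+2 then i * i else 2 * (i * (2 * p.+2 - i))
  | A2even p => if i == p.+1 then i * i else 2 * (i * (2 * p.+1 - i))
  | A2odd p => if i == p.+3 then i * i else 2 * (i * (2 * p.+3 - i))
  | D1 p => if (p.+3 <= i) then p.+3 * p.+3 else 2 * (i * (2 * p.+3 - i))
  | E6_1 => nth 0 [:: 0; 16; 30; 42; 30; 16; 22] i
  | E7_1 => nth 0 [:: 0; 34; 66; 96; 75; 52; 27; 49] i
  | E8_1 => nth 0 [:: 0; 58; 114; 168; 220; 270; 182; 92; 136] i
  | F4_1 => nth 0 [:: 0; 16; 30; 42; 22] i
  | G2_1 => nth 0 [:: 0; 6; 10] i
  | E6_2 => nth 0 [:: 0; 22; 42; 30; 16] i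
  | D4_3 => nth 0 [:: 0; 10; 6] i
  end%N.

Definition bond (X : affine_type) (i j : nat) : nat :=
  if (j != i) && joined X i j then multiplicity X i j else 0%N.

Lemma leq_sum_support (F : nat -> nat) n (s : seq nat) :
  (forall j, (0 < j <= n)%N -> F j != 0%N -> j \in s) ->
  (\sum_(j < n) F j.+1 <= \sum_(j <- s) F j)%N.
Proof.
move=> supp.
have -> : (\sum_(j < n) F j.+1 = \sum_(1 <= j < n.+1) F j)%N.
  by rewrite big_add1 big_mkord.
rewrite -(big_rmcond_in (fun j => F j != 0%N)); last by move=> j _ /negbNE/eqP.
rewrite -big_filter; apply: (sub_le_big_seq leqnn (fun x y => leq_addr y x)) => j.
rewrite count_uniq_mem ?filter_uniq ?iota_uniq // mem_filter mem_index_iota.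
by case: andP => // -[Fj /supp/(_ Fj)]; rewrite -has_pred1 has_count.
Qed.

(** The parabola with vertex n increases up to n.  This is row n of the Cartan
    matrix when the end node n carries a double bond. *)
Lemma vertex_dominant n : (0 < n)%N -> (n.-1 * (2 * n - n.-1) < n * (2 * n - n))%N.
Proof.
case: n => // n _; rewrite [n.+1.-1]/=.
have -> : (2 * n.+1 - n = n.+2)%N by lia.
have -> : (2 * n.+1 - n.+1 = n.+1)%N by lia.
nia.
Qed.

(** The second difference of i(C - i) is -2. *)
Lemma parabola_dominant C i : (0 < i < C)%N ->
  (i.-1 * (C - i.-1) + i.+1 * (C - i.+1) < 2 * (i * (C - i)))%N.
Proof.
case: i => // i /andP[_ /subnKC <-].
move: (C - _)%N => d; rewrite [i.+1.-1]/=.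
have -> : (i.+2 + d - i = d.+2)%N by lia.
have -> : (i.+2 + d - i.+2 = d)%N by lia.
have -> : (i.+2 + d - i.+1 = d.+1)%N by lia.
nia.
Qed.

(** Strict diagonal dominance of the Cartan matrix after rescaling by the heights:
    each row sees at most three neighbours, so the claim reduces to concavity of
    the parabola for the infinite families and to a computation for the others. *)
Lemma height_dominant X i : (0 < i <= rank X)%N ->
  (\sum_(j < rank X) bond X i j.+1 * height X j.+1 < 2 * height X i)%N.
Proof.
move=> ri; have [ri0 rin] := andP ri.
have few s :
  (forall j, (0 < j <= rank X)%N -> j != i -> joined X i j -> j \in s) ->
  (\sum_(j <- s) bond X i j * height X j < 2 * height X i)%N ->
  (\sum_(j < rank X) bond X i j.+1 * height X j.+1 < 2 * height X i)%N.
  move=> hs; apply: leq_ltn_trans; apply: leq_sum_support => j rj.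
  by rewrite /bond; case: andP => [[ne /(hs _ rj ne)]|].
have small :
  all (fun i => \sum_(j <- iota 1 (rank X)) bond X i j * height X j
                < 2 * height X i)%N (iota 1 (rank X)) ->
  (\sum_(j < rank X) bond X i j.+1 * height X j.+1 < 2 * height X i)%N.
  move=> /allP/(_ i); rewrite mem_iota => h.
  apply: (few (iota 1 (rank X))); last by apply: h; lia.
  by move=> j rj _ _; rewrite mem_iota; lia.
(* A node of a chain, with bonds at most u to the left and v to the right. *)
have step u v : ((1 < i) ==> (bond X i i.-1 <= u))%N ->
  (if i == rank X then v == 0%N else bond X i i.+1 <= v)%N -> height X 0 = 0%N ->
  (forall j, (0 < j <= rank X)%N -> j != i -> joined X i j -> consecutive i j) ->
  (u * height X i.-1 + v * height X i.+1 < 2 * height X i)%N ->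
  (\sum_(j < rank X) bond X i j.+1 * height X j.+1 < 2 * height X i)%N.
  move=> hu hv h0 cons.
  have {}hu : (bond X i i.-1 * height X i.-1 <= u * height X i.-1)%N.
    case: (ltnP 1 i) => [i1|i1]; first by rewrite leq_mul2r (implyP hu) ?orbT.
    by rewrite (_ : i.-1 = 0%N) ?h0 ?muln0 //; lia.
  case: eqVneq hv => [en|nen] hv.
    rewrite (eqP hv) mul0n addn0 => h; apply: (few [:: i.-1]).
      by move=> j rj ne /(cons _ rj ne); rewrite inE /consecutive; lia.
    by rewrite big_cons big_nil addn0; apply: leq_ltn_trans h.
  move=> h; apply: (few [:: i.-1; i.+1]).
    by move=> j rj ne /(cons _ rj ne); rewrite !inE /consecutive; lia.
  rewrite !big_cons big_nil addn0; apply: leq_ltn_trans h.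
  by apply: leq_add => //; rewrite leq_mul2r hv orbT.
case: X ri ri0 rin few small step =>
    [p|p|p|p||||||p|p|p||] ri ri0 rin few small step;
  try by apply: small; rewrite unlock; vm_compute.
- apply: (step 1%N (i < p.+1)%N); rewrite /bond /= /edge_of /consecutive
    ?inE ?xpair_eqE //=; rewrite /= in ri0 rin.
  + apply/implyP => i1; case: (p) rin => [|q] rin; repeat (case: ifP => ? //); lia.
  + case: (p) rin => [|q] rin; repeat (case: ifP => ? //); lia.
  + by move=> j; rewrite ?inE ?xpair_eqE; lia.
  + have := @parabola_dominant p.+2 i; have [h|h] := ltnP i p.+1; first by lia.
    have ip : i = p.+1 by lia.
    by rewrite ip; lia.
- apply: (step (if i == p.+3 then 2 else 1)%N (i < p.+3)%N); rewrite /bond /= /forked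
    ?inE ?xpair_eqE /consecutive //=; rewrite /= in ri0 rin.
  + by apply/implyP => i1; repeat (case: ifP => //); lia.
  + by repeat (case: ifP => //); lia.
  + by move=> j; rewrite ?inE ?xpair_eqE; lia.
  + have := @parabola_dominant (2 * p.+3) i; have := vertex_dominant (ltn0Sn p.+2).
    have [->|ne] := eqVneq i p.+3; first by rewrite ltnn; lia.
    by rewrite (_ : (i < p.+3)%N); lia.
- apply: (step 1 (if i == p.+2 then 0 else if i == p.+1 then 2 else 1))%N;
    rewrite /bond /= ?inE ?xpair_eqE /consecutive //=; rewrite /= in ri0 rin.
  + by apply/implyP => i1; repeat (case: ifP => //); lia.
  + by repeat (case: ifP => //); lia.
  + have := @parabola_dominant (2 * p.+2) i; have := vertex_dominant (ltn0Sn p.+1).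
    have [->|ne] := eqVneq i p.+2; first by rewrite ltn_eqF //=; lia.
    rewrite eqSS; have [->|ne'] := eqVneq i p.+2.-1.
      rewrite (ltn_eqF (_ : (p.+2.-1.-1 < p.+2)%N)); last by lia.
      by rewrite /=; lia.
    by rewrite (ltn_eqF (_ : (i.-1 < p.+2)%N)); lia.
- have b1 j : (bond (D1 p) i j <= 1)%N by rewrite /bond; case: ifP.
  have [ip|ip] := leqP p.+3 i.
    apply: (few [:: p.+2]).
      by move=> j; rewrite /= /forked /edge_of /consecutive ?inE ?xpair_eqE;
         rewrite /= in ri0 rin; lia.
    rewrite big_cons big_nil addn0.
    apply: leq_ltn_trans (leq_mul (b1 _) (leqnn _)) _.
    by rewrite /= ip ltnn (_ : 2 * p.+3 - p.+2 = p.+4)%N; last lia; nia.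
  have [ip'|ip'] := eqVneq i p.+2.
    apply: (few [:: p.+1; p.+3; p.+4]).
      by move=> j; rewrite /= /forked /edge_of /consecutive ?inE ?xpair_eqE;
         rewrite /= in ri0 rin; lia.
    rewrite !big_cons big_nil addn0.
    have b1M j c : (bond (D1 p) i j * c <= 1 * c)%N by rewrite leq_mul2r b1 orbT.
    apply: leq_ltn_trans (leq_add (b1M _ _) (leq_add (b1M _ _) (b1M _ _))) _.
    have e1 : (p.+2 < p.+1)%N = false by lia.
    have e4 : (p.+2 < p.+4)%N by lia.
    rewrite ip' /= !leqnn ltnn e1 e4.
    rewrite (_ : 2 * p.+3 - p.+2 = p.+4)%N; last lia.
    rewrite (_ : 2 * p.+3 - p.+1 = p.+3.+2)%N; last lia.
    nia.
  apply: (few [:: i.-1; i.+1]).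
    by move=> j; rewrite /= /forked /edge_of /consecutive ?inE ?xpair_eqE;
       rewrite /= in ri0 rin; lia.
  rewrite !big_cons big_nil addn0.
  have b1M j c : (bond (D1 p) i j * c <= 1 * c)%N by rewrite leq_mul2r b1 orbT.
  apply: leq_ltn_trans (leq_add (b1M _ _) (b1M _ _)) _.
  have /= := @parabola_dominant (2 * p.+3) i.
  have e0 : (p.+2 < i)%N = false by lia.
  have e1 : (p.+2 < i.-1)%N = false by lia.
  have e2 : (p.+2 < i.+1)%N = false by lia.
  by rewrite /= e0 e1 e2; lia.
- apply: (step 1 (if i == p.+1 then 0 else if i == p then 2 else 1))%N;
    rewrite /bond /= ?inE ?xpair_eqE /consecutive //=; rewrite /= in ri0 rin.
  + apply/implyP => i1; case: (p) rin => [|q];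
      rewrite ?inE ?xpair_eqE; repeat (case: ifP => //); lia.
  + case: (p) rin => [|q];
      rewrite ?inE ?xpair_eqE; repeat (case: ifP => //); lia.
  + have := @parabola_dominant (2 * p.+1) i; have := vertex_dominant (ltn0Sn p).
    have [->|ne] := eqVneq i p.+1; first by rewrite ltn_eqF //=; lia.
    rewrite eqSS; have [->|ne'] := eqVneq i p.+1.-1.
      rewrite (ltn_eqF (_ : (p.+1.-1.-1 < p.+1)%N)); last by lia.
      by rewrite /=; lia.
    by rewrite (ltn_eqF (_ : (i.-1 < p.+1)%N)); lia.
- apply: (step 1 (if i == p.+3 then 0 else if i == p.+2 then 2 else 1))%N;
    rewrite /bond /= /forked
    ?inE ?xpair_eqE /consecutive //=; rewrite /= in ri0 rin.
  + by apply/implyP => i1; repeat (case: ifP => //); lia.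
  + by repeat (case: ifP => //); lia.
  + by move=> j; rewrite ?inE ?xpair_eqE; lia.
  + have := @parabola_dominant (2 * p.+3) i; have := vertex_dominant (ltn0Sn p.+2).
    have [->|ne] := eqVneq i p.+3; first by rewrite ltn_eqF //=; lia.
    rewrite eqSS; have [->|ne'] := eqVneq i p.+3.-1.
      rewrite (ltn_eqF (_ : (p.+3.-1.-1 < p.+3)%N)); last by lia.
      by rewrite /=; lia.
    by rewrite (ltn_eqF (_ : (i.-1 < p.+3)%N)); lia.
- apply: (step (if i == p.+2 then 2 else 1)%N (i < p.+2)%N);
    rewrite /bond /= ?inE ?xpair_eqE /consecutive //=; rewrite /= in ri0 rin.
  + by apply/implyP => i1; repeat (case: ifP => //); lia.
  + by repeat (case: ifP => //); lia.
  + have := @parabola_dominant (2 * p.+2) i; have := vertex_dominant (ltn0Sn p.+1).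
    have [->|ne] := eqVneq i p.+2; first by rewrite ltnn; lia.
    by rewrite (_ : (i < p.+2)%N); lia.
Qed.

Lemma cartan_bond X i j :
  cartan X i j = if i == j then 2 else - (bond X i j)%:Z.
Proof.
rewrite /cartan /bond eq_sym; case: eqVneq => //= _.
by case: ifP => // _; rewrite oppr0.
Qed.

Lemma height_gt0 X i : (0 < i <= rank X)%N -> (0 < height X i)%N.
Proof.
by move=> ri; have := height_dominant ri; case: (height X i) => //; rewrite muln0.
Qed.

Section FormTheory.
Variable X : affine_type.
Implicit Types (u v : vec X) (i j : 'I_(rank X)).

Lemma vec_rootE v : v = \sum_i v i 0 *: root i.
Proof.
apply/matrixP => k l; rewrite summxE (bigD1 k) //= ord1 big1 => [|j ne].
  by rewrite !mxE !eqxx mulr1 addr0.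
by rewrite !mxE eq_sym (negPf ne) mulr0.
Qed.

Lemma form_corootE v i :
  form v (coroot i) = \sum_j v j 0 * (cartan X i.+1 j.+1)%:~R.
Proof.
rewrite [v in LHS]vec_rootE form_suml; apply: eq_bigr => j _.
by rewrite formZl form_root_coroot.
Qed.

(** Maximum principle: if v is orthogonal to all coroots, consider a node i at
    which |v_i| / height i is maximal.  Row i of the Cartan matrix expresses
    2 v_i by the neighbours, and strict dominance contradicts maximality. *)
Lemma form_nondegenerate v : (forall i, form v (coroot i) = 0) -> v = 0.
Proof.
move=> v0; apply/matrixP => j0 l; rewrite ord1 mxE; apply/eqP/negPn/negP => vj0.
have hp i : 0 < (height X i.+1)%:R :> rat by rewrite ltr0n height_gt0 //= ltn_ord.
pose F i := `|v i 0| / (height X i.+1)%:R.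
have [i _ maxi] := @Order.TotalTheory.arg_maxP _ _ _ j0 xpredT F isT.
have Fi : 0 < F i.
  by apply: lt_le_trans (maxi j0 isT); rewrite divr_gt0 ?normr_gt0.
have := v0 i; rewrite form_corootE (bigD1 i) //= cartan_bond eqxx => /eqP.
rewrite addr_eq0 => /eqP/(congr1 Num.norm); rewrite normrN normrM => e.
have le : `|\sum_(j | j != i) v j 0 * (cartan X i.+1 j.+1)%:~R| <=
    F i * (\sum_(j < rank X) bond X i.+1 j.+1 * height X j.+1)%N%:R.
  apply: le_trans (ler_norm_sum _ _ _) _.
  rewrite natr_sum mulr_sumr [leRHS](bigD1 i) //=.
  rewrite ler_wpDl ?(mulr_ge0 (ltW Fi)) ?ler0n //.
  apply: ler_sum => j ne; rewrite cartan_bond eqSS eq_sym (inj_eq val_inj) (negPf ne).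
  rewrite normrM mulrNz normrN -pmulrn normr_nat natrM mulrCA mulrC.
  rewrite ler_wpM2l ?ler0n // -ler_pdivrMr //; exact: maxi.
have := height_dominant (_ : 0 < i.+1 <= rank X)%N; rewrite /= ltn_ord => /(_ isT).
rewrite -(ltr_nat rat) -(ltr_pM2l Fi) => lt.
have eF : F i * (height X i.+1)%:R = `|v i 0| by rewrite divfK ?gt_eqF.
have := le_lt_trans le lt; rewrite -e natrM [2%:R * _]mulrC [ltRHS]mulrA eF.
by rewrite normr_nat mulrC ltxx.
Qed.

End FormTheory.

(** * Dual bases and finite quotients of lattices *)
Lemma level_scaledP X k (b : 'I_(rank X) -> vec X) (c : 'I_(rank X) -> int) :
  level_scaled k (span_pred b) (\sum_i ((c i)%:~R *+ k) *: b i).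
Proof.
exists (\sum_i b i *~ c i).
  by rewrite rpred_sum // => i _; rewrite rpredMz ?mem_span.
by rewrite -sumrMnl; apply: eq_bigr => i _; rewrite -scalerMnl scaler_int.
Qed.

Section DualBasis.
Variable X : affine_type.
Implicit Types (u v : vec X) (i j : 'I_(rank X)) (b : 'I_(rank X) -> vec X).

Definition separating b := forall v, (forall i, form v (b i) = 0) -> v = 0.

Lemma coroot_separating : separating (@coroot X).
Proof. exact: form_nondegenerate. Qed.

Lemma root_separating : separating (@root X).
Proof.
move=> v v0; apply: form_nondegenerate => i.
by rewrite corootE formZr v0 mulr0.
Qed.

Lemma dual_basis b : separating b -> exists d : 'I_(rank X) -> vec X,
  [/\ forall i j, form (d i) (b j) = (i == j)%:R,
      forall v, v = \sum_i form v (b i) *: d i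
    & forall v, v = \sum_i form v (d i) *: b i].
Proof.
move=> sep; pose B := \matrix_(i, j) form (root j) (b i).
have BE v : B *m v = \col_i form v (b i).
  apply/matrixP => i k; rewrite ord1 !mxE [v in RHS]vec_rootE form_suml.
  by apply: eq_bigr => j _; rewrite mxE formZl mulrC.
have uB : B \in unitmx.
  rewrite -unitmx_tr -row_free_unit; apply: inj_row_free => w Bw0.
  apply: trmx_inj; rewrite trmx0; apply: sep => i.
  have := congr1 trmx Bw0; rewrite trmx_mul trmxK trmx0 BE.
  by move=> /matrixP/(_ i 0); rewrite !mxE.
pose d i : vec X := invmx B *m delta_mx i 0.
have dE i j : form (d i) (b j) = (i == j)%:R.
  have := BE (d i); rewrite mulKVmx // => /matrixP/(_ j 0); rewrite !mxE andbT => <-.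
  by rewrite eq_sym.
have d1 v : v = \sum_i form v (b i) *: d i.
  apply/eqP; rewrite -subr_eq0; apply/eqP/sep => j.
  rewrite formDl formNl form_suml (bigD1 j) //= big1 => [|i ne]; rewrite formZl dE.
    by rewrite eqxx mulr1 addr0 subrr.
  by rewrite (negPf ne) mulr0.
exists d; split => // v.
apply/eqP; rewrite -subr_eq0; apply/eqP/sep => j.
rewrite (d1 (b j)) formC form_suml big1 // => i _.
rewrite formZl formDr formNr [form (d i) (\sum__ _)]formC form_suml.
rewrite (bigD1 i) //= big1 => [|k ne].
  rewrite formZl [form (b i) _]formC dE eqxx mulr1 addr0.
  by rewrite [form (d i) v]formC subrr mulr0.
by rewrite formZl [form (b k) _]formC dE eq_sym (negPf ne) mulr0.
Qed.

(** The double dual of the lattice spanned by b is the lattice itself, at level k: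
    test v against the dual basis. *)
Lemma level_separation b k v : separating b ->
  (forall u, u \in dual_pred (span_pred b) -> exists z : int, form u v = z%:~R *+ k) ->
  level_scaled k (span_pred b) v.
Proof.
move=> /dual_basis[d [dE _ d2]] vk.
have /choice[c cE] i : exists z : int, form (d i) v = z%:~R *+ k.
  apply: vk; apply/dual_spanP => j; rewrite dE.
  by case: (_ == _); rewrite ?rpred1 ?rpred0.
rewrite (d2 v); under eq_bigr => i _ do rewrite formC cE.
exact: level_scaledP.
Qed.

(** The dual of one full lattice modulo k times another one is a finitely generated
    torsion group: multiplying by k and by all denominators of the change of basis
    moves the dual basis of b into k times the span of b'. *)
Lemma dual_finite_exponent b b' k : separating b -> separating b' -> (0 < k)%N ->
  exists (d : 'I_(rank X) -> vec X) (N : nat),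
  [/\ (0 < N)%N, forall i, d i \in dual_pred (span_pred b),
      forall i, level_scaled k (span_pred b') (d i *+ N)
    & forall v, v \in dual_pred (span_pred b) ->
        exists c : 'I_(rank X) -> int, v = \sum_i d i *~ c i].
Proof.
move=> /dual_basis[d [dE d1 _]] /dual_basis[d' [_ _ d2']] k0.
pose x i j := form (d i) (d' j).
pose D := (\prod_i \prod_j `|denq (x i j)|)%N.
exists d, (k * D)%N; split.
- rewrite muln_gt0 k0 prodn_gt0 // => i; rewrite prodn_gt0 // => j.
  by rewrite absz_gt0 denq_neq0.
- move=> i; apply/dual_spanP => j; rewrite dE.
  by case: (_ == _); rewrite ?rpred1 ?rpred0.
- move=> i; have /choice[c cE] j : exists z : int, D%:R * x i j = z%:~R.
    have [q ->] : exists q, D = (q * `|denq (x i j)|)%N.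
      exists (D %/ `|denq (x i j)|)%N; rewrite divnK //.
      by rewrite /D (bigD1 i) //= (bigD1 j) //= -mulnA dvdn_mulr.
    exists (q%:Z * numq (x i j)); rewrite natrM intrM -mulrA; congr (_ * _).
    by rewrite pmulrn absz_denq mulrC -numqE.
  rewrite (_ : d i *+ _ = \sum_j ((c j)%:~R *+ k) *: b' j); first exact: level_scaledP.
  rewrite {1}(d2' (d i)) mulrnA -!sumrMnl; apply: eq_bigr => j _.
  by rewrite mulrnAC -cE mulr_natl !scalerMnl.
- move=> v /dual_spanP vb; have /choice[c cE] i : exists z : int, form v (b i) = z%:~R.
    by have /intrP[z ->] := vb i; exists z.
  exists c; rewrite {1}(d1 v); apply: eq_bigr => i _.
  by rewrite cE scaler_int.
Qed.

End DualBasis.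

(** * Parity of the norms and the type A_2n^(2) *)
Definition is_A2even (X : affine_type) : bool := if X is A2even _ then true else false.

Lemma colabel_dvd X i : (0 < i)%N -> (colabel X i %| tier X * label X i)%N.
Proof.
case: X => [p|p|p|p||||||p|p|p||] //=;
  try (by case: i => // i _; repeat case: ifP => ? //; lia).
all: by case: i => // i _; do 10 (case: i => [|i] //).
Qed.

Lemma A2even_colabel X i : is_A2even X -> colabel X i.+1 = 2%N.
Proof. by case: X. Qed.

Lemma untwisted_tier X : ~~ is_A2even X -> (tier X <= label X 0)%N -> tier X = 1%N.
Proof. by case: X. Qed.

Section Parity.
Variable X : affine_type.
Implicit Types (u v : vec X) (i j : 'I_(rank X)).

Lemma form_coroot i j : form (coroot i) (coroot j) =
  (label X i.+1)%:R / (colabel X i.+1)%:R * (cartan X j.+1 i.+1)%:~R.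
Proof. by rewrite {1}corootE formZl form_root_coroot. Qed.

Lemma span_form_int (b : 'I_(rank X) -> vec X) (t : rat) u v :
  (forall i, t * form u (b i) \is a Num.int) -> v \in span_pred b ->
  t * form u v \is a Num.int.
Proof.
move=> ub /asboolP[c ->]; rewrite formC form_suml mulr_sumr rpred_sum // => i _.
by rewrite formMzl mulrCA rpredM ?intr_int // formC.
Qed.

(** The polarization of t <v, v>/2 is t <u, v>, so integrality on a basis spreads
    to the lattice. *)
Lemma half_form_int (b : 'I_(rank X) -> vec X) (t : rat) :
  (forall i j, t * form (b i) (b j) \is a Num.int) ->
  (forall i, t * form (b i) (b i) / 2 \is a Num.int) ->
  forall v, v \in span_pred b -> t * form v v / 2 \is a Num.int.
Proof.
move=> offd diag _ /asboolP[c ->].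
suff [] : \sum_i b i *~ c i \in span_pred b /\
  t * form (\sum_i b i *~ c i) (\sum_i b i *~ c i) / 2 \is a Num.int by [].
elim/big_ind: _ => [|u v [su qu] [sv qv]|i _].
- by rewrite rpred0 form0l mulr0 mul0r.
- split; first exact: rpredD.
  have uv : t * form u v \is a Num.int.
    apply: span_form_int sv => i; rewrite formC; apply: span_form_int su => j.
    exact: offd.
  rewrite (_ : _ / 2 = t * form u u / 2 + t * form v v / 2 + t * form u v) ?rpredD //.
  by rewrite formDl !formDr (formC v u); field.
- split; first by rewrite rpredMz ?mem_span.
  rewrite formMzl formMzr.
  rewrite (_ : _ / 2 = (c i)%:~R * (c i)%:~R * (t * form (b i) (b i) / 2)).
    by rewrite rpredM ?diag // rpredM ?intr_int.
  by ring.
Qed.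

Lemma dvdn_ratio_int (p q : nat) : (p %| q)%N -> q%:R / p%:R \is a (@Num.int rat).
Proof.
move=> /dvdnP[s ->]; have [->|p0] := eqVneq p 0%N; first by rewrite muln0 mul0r rpred0.
by rewrite natrM mulfK ?pnatr_eq0 // natr_int.
Qed.

(** M is an even lattice except in type A_2n^(2), where the coroot of the long
    simple root has norm 1. *)
Lemma M_basis : exists b : 'I_(rank X) -> vec X,
  [/\ separating b, M_lattice X =i span_pred b,
      forall i j, form (b i) (b j) \is a Num.int &
      ~~ is_A2even X -> forall i, form (b i) (b i) / 2 \is a Num.int].
Proof.
rewrite /M_lattice; case: ifPn => [untwisted|twisted]; last first.
  have int i : (colabel X i.+1)%:R / (label X i.+1)%:R \is a (@Num.int rat).
    by apply: dvdn_ratio_int; case/andP: (label_dvd twisted (ltn0Sn i)).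
  exists (@root X); split=> // [|i j|_ i].
  - exact: root_separating.
  - by rewrite form_root rpredM ?intr_int.
  - by rewrite form_root gram_diag mulrC mulKf ?pnatr_eq0.
exists (@coroot X); split=> // [|i j|nA i].
- exact: coroot_separating.
- have [A|nA] := boolP (is_A2even X).
    (* Only the last simple root has label 1; its coroot is half of it. *)
    wlog ln : i j / label X i.+1 = 2%N => [IH|].
      have [lin|li] := eqVneq (label X i.+1) 2%N; first exact: IH.
      have [ljn|lj] := eqVneq (label X j.+1) 2%N; first by rewrite formC; exact: IH.
      have := form_coroot i j; move: i j li lj {IH untwisted}.
      case: X A => // p _ i j /=.
      case: ifP => // /eqP[ei] _; case: ifP => // /eqP[ej] _.
      have -> : i = j by apply: val_inj; rewrite /= ei ej.
      by move=> ->; rewrite /cartan eqxx.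
    rewrite form_coroot ln (A2even_colabel _ A).
    by rewrite divff // mul1r intr_int.
  rewrite form_coroot rpredM ?intr_int // dvdn_ratio_int //.
  by have := @colabel_dvd X i.+1 isT; rewrite untwisted_tier ?mul1n.
rewrite form_coroot /cartan eqxx mulrAC -mulrA divff // mulr1 dvdn_ratio_int //.
by have := @colabel_dvd X i.+1 isT; rewrite untwisted_tier ?mul1n.
Qed.

Lemma coroot_even v : v \in coroot_lattice X ->
  (tier X)%:R * form v v / 2 \is a Num.int.
Proof.
have int i :
    (tier X)%:R * ((label X i.+1)%:R / (colabel X i.+1)%:R) \is a (@Num.int rat).
  by rewrite mulrA -natrM dvdn_ratio_int ?colabel_dvd.
apply: half_form_int => [i j|i].
  by rewrite form_coroot mulrA rpredM ?intr_int ?int.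
by rewrite form_coroot /cartan eqxx !mulrA mulfK // -mulrA int.
Qed.

End Parity.

(** Row sums of a tridiagonal matrix. *)
Lemma sum_window (V : zmodType) (F : nat -> V) n i : (0 < i <= n)%N ->
  (forall j, (j <= n.+1)%N -> (j < i.-1)%N || (i.+1 < j)%N -> F j = 0) ->
  F 0 = 0 -> F n.+1 = 0 ->
  \sum_(j < n) F j.+1 = F i.-1 + F i + F i.+1.
Proof.
case: i => // i /andP[_ lin] F0 F00 F01.
have -> : \sum_(j < n) F j.+1 = \sum_(0 <= j < n.+2) F j.
  rewrite big_mkord big_ord_recl big_ord_recr /= F00 F01 add0r addr0.
  exact: eq_bigr.
rewrite (big_cat_nat (n := i)) //=; last by lia.
rewrite big_nat_cond big1 ?add0r; last by move=> j /andP[/andP[_ ji] _]; apply: F0; lia.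
rewrite (big_cat_nat (n := i.+3)) //=; last by lia.
rewrite [X in _ + X]big_nat_cond [X in _ + X]big1 ?addr0; last first.
  by move=> j /andP[/andP[ji jn] _]; apply: F0; lia.
have e3 : (i.+3 - i = 3)%N by lia.
by rewrite /index_iota e3 /= !big_cons big_nil addr0 addrA.
Qed.

Lemma cartan_A2even p i :
  [/\ cartan (A2even p) i.+1 i = -1, cartan (A2even p) i.+1 i.+1 = 2
    & cartan (A2even p) i.+1 i.+2 = - (if i.+1 == p then 2 else 1)].
Proof.
rewrite /cartan eqxx (gtn_eqF (ltnSn i)) (ltn_eqF (ltnSn i.+1)).
rewrite /joined /consecutive !eqxx orbT /=; split=> //.
  by case: p => [|q] //; rewrite !inE !xpair_eqE; case: ifP => //; lia.
by case: p => [|q] //; rewrite !inE !xpair_eqE !eqSS andbb /=; case: eqP.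
Qed.

Section A2even.
Variables (p : nat).
Local Notation X := (A2even p).
Local Notation n := (rank X).

(** Coordinates numbered by the nodes 1, ..., n and extended by 0, so that the rows
    at both ends of the chain need no separate treatment. *)
Definition coord0 (v : vec X) (j : nat) : rat :=
  if insub j.-1 is Some i then if j is 0 then 0 else v i 0 else 0.

Lemma coord0S v (j : 'I_n) : coord0 v j.+1 = v j 0.
Proof. by rewrite /coord0 /= valK. Qed.

Lemma A2even_coroot_form v (i : 'I_n) :
  form v (coroot i) =
    2 * coord0 v i.+1 - coord0 v i - (if i.+1 == p then 2 else 1) * coord0 v i.+2.
Proof.
rewrite form_corootE.
under eq_bigr => j _ do rewrite -coord0S.
have out : coord0 v n.+1 = 0.
  by rewrite /coord0; case: insubP => //= k; rewrite ltnn.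
rewrite (sum_window (F := fun j => coord0 v j * (cartan X i.+1 j)%:~R) (i := i.+1)).
- have [-> -> ->] := cartan_A2even p i.
  by case: ifP => _; ring.
- by rewrite /= ltn_ord.
- move=> j jn h; rewrite cartan_bond /bond /= /consecutive.
  rewrite (_ : (i.+1 == j) = false); last first.
    by apply/negbTE; apply/eqP; move: h; rewrite /=; lia.
  case: ifP => [|_]; last by rewrite oppr0 mulr0.
  move: h; rewrite /=; lia.
- by rewrite /coord0; case: insub => [?|]; rewrite mul0r.
- by rewrite out mul0r.
Qed.

(** Let c_j be the coordinates of v in the basis of coroots.  Pairing v with the
    coroot j gives (c_j - c_(j-1)) - (c_(j+1) - c_j), and c_n - c_(n-1) at the last
    node.  Hence all differences are integers by descending induction, and then all
    c_j by ascending induction from c_0 = 0. *)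
Lemma A2even_weight_sub_coroot v : v \in weight_lattice X -> v \in coroot_lattice X.
Proof.
move=> /dual_spanP vP.
have row j : (0 < j <= n)%N ->
    2 * coord0 v j - coord0 v j.-1 - (if j == p then 2 else 1) * coord0 v j.+1
      \is a Num.int.
  by case: j => // j /= jn; have := vP (Ordinal jn); rewrite A2even_coroot_form.
(* The last simple root is twice its coroot. *)
pose c j := (if j == n then 2 else 1) * coord0 v j.
have diff d j : (j + d = n)%N -> (0 < j)%N -> c j - coord0 v j.-1 \is a Num.int.
  elim: d j => [|d IH] j jd j0.
    have := row n; rewrite -jd addn0 leqnn j0 => /(_ isT); rewrite /c.
    have -> : j = n by rewrite -jd addn0.
    rewrite (_ : coord0 v n.+1 = 0) ?eqxx ?mulr0 ?subr0 //.
    by rewrite /coord0; case: insubP => //= k; rewrite ltnn.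
  have /(row j) : (0 < j <= n)%N by lia.
  have := IH j.+1 _ isT; rewrite addSnnS => /(_ jd) h1 h2.
  rewrite (_ : c j - _ = (c j.+1 - coord0 v j.+1.-1) +
    (2 * coord0 v j - coord0 v j.-1 - (if j == p then 2 else 1) * coord0 v j.+1)).
    exact: rpredD h1 h2.
  rewrite /c /= eqSS (ltn_eqF (_ : j < p.+1)%N); last by rewrite /= in jd; lia.
  by case: ifP => _; ring.
have cint j : (j <= n)%N -> c j \is a Num.int /\ (j < n -> coord0 v j \is a Num.int)%N.
  elim: j => [|j IH] jn.
    by rewrite /c /coord0; case: insub => [?|]; rewrite mulr0 rpred0.
  have [_ /(_ jn) wj] := IH (ltnW jn).
  have cj : c j.+1 \is a Num.int.
    have := diff (n - j.+1)%N j.+1; rewrite subnKC // => /(_ erefl isT) d.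
    by rewrite -(subrK (coord0 v j) (c _)); exact: rpredD d wj.
  by split=> // jn'; move: cj; rewrite /c (ltn_eqF jn') mul1r.
apply/asboolP.
have /choice[z zE] (i : 'I_n) : exists z : int, c i.+1 = z%:~R.
  by have /intrP[z ->] := (cint i.+1 (ltn_ord i)).1; exists z.
exists z; rewrite {1}(vec_rootE v); apply: eq_bigr => i _.
rewrite -scaler_int -zE corootE scalerA /c coord0S; congr (_ *: _).
by rewrite /= !eqSS; case: ifP => _; field.
Qed.

End A2even.

(** * Generators of Gamma_1(r) for r at most 3 *)
Section CongruenceGenerators.
Variable r : nat.
Local Notation Gamma := (Gamma1 r).

Definition mx2 (a b c d : int) : 'M[int]_2 :=
  \matrix_(i, j) if i == 0 then if j == 0 then a else b else if j == 0 then c else d.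

Lemma mx2_entries a b c d : [/\ mx2 a b c d 0 0 = a, mx2 a b c d 0 1 = b,
  mx2 a b c d 1 0 = c & mx2 a b c d 1 1 = d].
Proof. by rewrite !mxE. Qed.

Lemma mulmx2 (g h : 'M[int]_2) i j : (g *m h) i j = g i 0 * h 0 j + g i 1 * h 1 j.
Proof.
rewrite mxE !big_ord_recl big_ord0 addr0.
by rewrite (_ : lift ord0 ord0 = 1) //; apply/eqP.
Qed.

Lemma mx2_Gamma1 (a b c d : int) : a * d - b * c = 1 ->
  (r %| (a - 1)%R)%Z -> (r %| c)%Z -> (r %| (d - 1)%R)%Z ->
  mx2 a b c d \in Gamma1_pred r.
Proof.
move=> det1 ra rc rd; rewrite unfold_in; have [-> _ -> ->] := mx2_entries a b c d.
rewrite ra rc rd !andbT (expand_det_row _ 0) !big_ord_recl big_ord0 addr0 /cofactor.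
rewrite !det_mx11 !mxE /= expr0 expr1 mul1r mulN1r mulrN -det1.
by apply/eqP; congr (_ - _).
Qed.

Lemma upper_Gamma1 (n : int) : mx2 1 n 0 1 \in Gamma1_pred r.
Proof. by apply: mx2_Gamma1; rewrite ?subrr ?dvdz0 // mulr1 mulr0 subr0. Qed.

Lemma lower_Gamma1 (n : int) : mx2 1 0 (r%:Z * n) 1 \in Gamma1_pred r.
Proof. by apply: mx2_Gamma1; rewrite ?subrr ?dvdz0 ?dvdz_mulr // mulr1 mul0r subr0. Qed.

Definition upper n : Gamma := GammaMx (upper_Gamma1 n).
Definition lower n : Gamma := GammaMx (lower_Gamma1 n).

Lemma Gamma1_ext (g h : Gamma) : g 0 0 = h 0 0 -> g 0 1 = h 0 1 ->
  g 1 0 = h 1 0 -> g 1 1 = h 1 1 -> g = h.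
Proof.
move=> e00 e01 e10 e11; apply/val_inj/matrixP => i j.
have two (k : 'I_2) : k = 0 \/ k = 1.
  by case: k => [[|[|//]] lt]; [left|right]; apply: val_inj.
by case: (two i) => ->; case: (two j) => ->.
Qed.

Lemma centered_mod (a c : int) : c != 0 -> exists n : int, `|a + n * c| * 2 <= `|c|.
Proof.
move=> c0; have := divz_eq a c; have := modz_ge0 a c0; have := ltz_mod a c0.
set q := (a %/ c)%Z; set m := (a %% c)%Z => lt ge e.
have [le|gt] := leP (m * 2) `|c|.
  by exists (- q); rewrite e; lia.
by exists (- q - Num.sg c); rewrite e; lia.
Qed.

(** Euclidean algorithm on the first column (a, c).  Left multiplication by an upper
    matrix makes |a| <= |c|/2, then a lower one makes |c| <= r |a|/2 <= 3|c|/4, which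
    is a strict decrease.  At c = 0 the matrix is upper triangular with diagonal
    entries both 1 or both -1. *)
Lemma Gamma1_ind (S : Gamma -> Prop) : (0 < r <= 3)%N ->
  (forall n, S (upper n)) -> (forall n, S (lower n)) ->
  (forall g : Gamma, g 0 0 = -1 -> g 0 1 = 0 -> g 1 0 = 0 -> g 1 1 = -1 -> S g) ->
  (forall g h, S g -> S h -> S (g * h)%g) -> forall g, S g.
Proof.
move=> /andP[r0 r3] Su Sl Sn SM g.
have upM n (h : Gamma) : ((upper n * h)%g : Gamma) 0 0 = h 0 0 + n * h 1 0 /\
    ((upper n * h)%g : Gamma) 1 0 = h 1 0.
  have [e0 e1 e2 e3] := mx2_entries 1 n 0 1.
  by rewrite /= !mulmx2 e0 e1 e2 e3; split; ring.
have loM n (h : Gamma) : ((lower n * h)%g : Gamma) 0 0 = h 0 0 /\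
    ((lower n * h)%g : Gamma) 1 0 = h 1 0 + r%:Z * n * h 0 0.
  have [e0 e1 e2 e3] := mx2_entries 1 0 (r%:Z * n) 1.
  by rewrite /= !mulmx2 e0 e1 e2 e3; split; ring.
have unup n h : S (upper n * h)%g -> S h.
  move=> H; rewrite (_ : h = upper (- n) * (upper n * h))%g; first exact: SM.
  rewrite mulgA (_ : (upper (- n) * upper n)%g = 1%g) ?mul1g //.
  have [e0 e1 e2 e3] := mx2_entries 1 n 0 1.
  have [e0' e1' e2' e3'] := mx2_entries 1 (- n) 0 1.
  apply: Gamma1_ext; rewrite /= mulmx2 ?e0 ?e1 ?e2 ?e3 ?e0' ?e1' ?e2' ?e3' mxE /=;
    ring.
have unlo n h : S (lower n * h)%g -> S h.
  move=> H; rewrite (_ : h = lower (- n) * (lower n * h))%g; first exact: SM.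
  rewrite mulgA (_ : (lower (- n) * lower n)%g = 1%g) ?mul1g //.
  have [e0 e1 e2 e3] := mx2_entries 1 0 (r%:Z * n) 1.
  have [e0' e1' e2' e3'] := mx2_entries 1 0 (r%:Z * - n) 1.
  apply: Gamma1_ext; rewrite /= mulmx2 ?e0 ?e1 ?e2 ?e3 ?e0' ?e1' ?e2' ?e3' mxE /=;
    ring.
have [N] := ubnP `|(g 1 0)%R|%N; elim: N g => // N IH g gN.
have det := Gamma1_det g.
have [c0|c0] := eqVneq (g 1 0) 0.
  have [[a d]|[a d]] : (g 0 0 = 1 /\ g 1 1 = 1) \/ (g 0 0 = -1 /\ g 1 1 = -1).
    move: det; rewrite c0 mulr0 subr0 => e; have := congr1 absz e.
    move=> /eqP; rewrite abszM muln_eq1 => /andP[/eqP ha /eqP hd].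
    by have [|] := leP 0 (g 0 0); have [|] := leP 0 (g 1 1); nia.
  - rewrite (_ : g = upper (g 0 1)) //.
    have [e0 e1 e2 e3] := mx2_entries 1 (g 0 1) 0 1.
    by apply: Gamma1_ext; rewrite /= ?e0 ?e1 ?e2 ?e3 ?a ?c0 ?d.
  - apply: (unup (g 0 1)); have [e0 e1 e2 e3] := mx2_entries 1 (g 0 1) 0 1.
    by apply: Sn; rewrite /= mulmx2 ?e0 ?e1 ?e2 ?e3 ?a ?d ?c0; ring.
have [n hn] := centered_mod (g 0 0) c0.
apply: (unup n); have [] := upM n g; move: (upper n * g)%g => h ha hc.
rewrite -ha -hc in hn c0 gN; have := Gamma1_det h => {}det.
have [a0|a0] := eqVneq (h 0 0) 0.
  (* If a vanishes then c is a unit and a multiple of r, so r = 1: add c to a first. *)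
  have cc : h 0 1 * h 1 0 = -1 by move: det; rewrite a0; lia.
  have := congr1 absz cc; move=> /eqP; rewrite abszM muln_eq1 => /andP[_ /eqP hc1].
  have r1 : r = 1%N.
    have /and4P[_ _ + _] := valP h; rewrite dvdzE /=.
    by rewrite (_ : `|(val h 1 0)%R|%N = 1%N) // dvdn1 => /eqP.
  apply: (unup 1); have [] := upM 1 h; move: (upper 1 * h)%g => h' ha' hc'.
  apply: (unlo (- 1)); apply: IH; have [_ ->] := loM (- 1) h'.
  have r1z : r%:Z = 1 by rewrite r1.
  by rewrite ha' hc' a0 r1z; lia.
have rh0 : r%:Z * h 0 0 != 0 by rewrite mulf_neq0 // eqz_nat -lt0n.
have [k hk] := centered_mod (h 1 0) rh0.
apply: (unlo k); apply: IH; have [_ ->] := loM k h.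
have : `|r%:Z * h 0 0| <= 3 * `|h 0 0| by rewrite normrM ler_wpM2r.
rewrite -mulrA [k * _]mulrC mulrA.
by rewrite mulrC in hk; lia.
Qed.

End CongruenceGenerators.

(** * Sums over finite groups *)

(** The quotients G and B below are not declared as finite types; sums over them run
    over a complete list without repetitions. *)
Definition enumerates (T : eqType) (s : seq T) := uniq s /\ forall x, x \in s.

Lemma enumerable_torsion (V : zmodType) n (g : 'I_n -> V) N : (0 < N)%N ->
  (forall i, g i *+ N = 0) ->
  (forall v, exists c : 'I_n -> int, v = \sum_i g i *~ c i) ->
  exists s : seq V, enumerates s.
Proof.
case: N => // N _ gN gen.
exists (undup [seq \sum_i g i *+ f i | f : {ffun 'I_n -> 'I_N.+1}]).
split=> [|v]; first exact: undup_uniq.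
rewrite mem_undup; have [c ->] := gen v; apply/mapP.
exists [ffun i => inord `|(c i %% N.+1)%Z|%N]; first by rewrite mem_enum.
apply: eq_bigr => i _; rewrite ffunE inordK; last first.
  by rewrite -ltz_nat gez0_abs ?modz_ge0 // ltz_pmod.
rewrite pmulrn gez0_abs ?modz_ge0 // {1}(divz_eq (c i) N.+1).
by rewrite mulrzDr mulrC mulrzA -pmulrn gN mul0rz add0r.
Qed.

Section EnumeratedSums.
Variables (T : eqType) (s : seq T) (V : nmodType).
Hypothesis s_all : enumerates s.

Lemma sum_reindex (h h' : T -> T) (F : T -> V) : cancel h h' -> cancel h' h ->
  \sum_(x <- s) F (h x) = \sum_(x <- s) F x.
Proof.
move=> hK h'K; have [us ms] := s_all; rewrite -(big_map h xpredT F).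
apply: perm_big; apply: uniq_perm => //.
  by rewrite map_inj_uniq //; exact: can_inj hK.
by move=> x; rewrite ms -[x]h'K map_f.
Qed.

Lemma sum_indicator (x : T) (F : T -> V) : (forall y, y != x -> F y = 0) ->
  \sum_(y <- s) F y = F x.
Proof.
move=> F0; have [us ms] := s_all.
by rewrite (bigD1_seq x) //= big1 ?addr0.
Qed.

End EnumeratedSums.

(** Translating by b shows that the sum equals chi b times itself. *)
Lemma sum_character (V : zmodType) (s : seq V) (F : idomainType) (chi : V -> F) b :
  enumerates s -> (forall x y, chi (x + y) = chi x * chi y) -> chi b != 1 ->
  \sum_(x <- s) chi x = 0.
Proof.
move=> sV chiD chib; apply/eqP; rewrite -[_ == 0]orFb -(negPf chib) -subr_eq0 -mulf_eq0.
rewrite mulrBl mul1r subr_eq0 mulr_sumr; apply/eqP.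
rewrite -[RHS](sum_reindex sV chi (addKr b) (addNKr b)).
by apply: eq_bigr => x _; rewrite chiD.
Qed.

(** * Phases *)
Section Phase.
Variables (R : realType) (X : affine_type) (l : nat).
Local Notation k := (level X l).
Local Notation phase := (phase R X l).

Lemma phase_neq0 u : phase u != 0.
Proof.
apply/eqP => u0; have := phaseD R X l u (- u).
by rewrite subrr phase0 u0 mul0r => /eqP; rewrite oner_eq0.
Qed.

Lemma phaseN u : phase (- u) = (phase u)^-1.
Proof.
apply: (mulfI (phase_neq0 u)); rewrite -phaseD subrr phase0 divff //.
exact: phase_neq0.
Qed.

Definition level_multiple (u : rat) : Prop := exists z : int, u = z%:~R *+ k.

Lemma phase_multiple u : level_multiple u -> phase u = 1.
Proof. by move=> [z ->]; rewrite phase_level. Qed.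

Lemma phase_cong u v : level_multiple (u - v) -> phase u = phase v.
Proof. by move=> uv; rewrite -[u](subrK v) phaseD phase_multiple // mul1r. Qed.

(** Reduce u to w in [0, k).  Then cos (2 t) = 1 for t = pi w/k in [0, pi), so that
    sin t = 0, which forces t = 0. *)
Lemma phase_eq1 u : (0 < k)%N -> phase u = 1 -> level_multiple u.
Proof.
move=> k0 u1; have kq : 0 < k%:R :> rat by rewrite ltr0n.
pose z := Num.floor (u / k%:R).
exists z; apply/eqP; rewrite -subr_eq0; apply/eqP.
set w := u - _; have w1 : phase w = 1.
  by rewrite phaseD phaseN phase_level u1 divr1.
have wE : w = (u / k%:R - z%:~R) * k%:R by rewrite mulrBl divfK ?gt_eqF // mulr_natr.
have w0 : 0 <= w by rewrite wE mulr_ge0 ?subr_ge0 ?floor_le // ltW.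
have wk : w < k%:R.
  by rewrite wE gtr_pMl // ltrBlDl; have := floorD1_gt (u / k%:R); rewrite intrD.
apply/eqP; rewrite eq_le w0 andbT leNgt; apply/negP => wpos.
move: w1 => /(congr1 (@complex.Re R)); rewrite /Defs.phase /=.
pose t : R := pi * ratr w / k%:R.
have -> : 2 * pi * ratr w / k%:R = t *+ 2 by rewrite -[t *+ 2]mulr_natl /t !mulrA.
rewrite cos_mulr2n => e.
have : 0 < sin t.
  apply: sin_gt0_pi; apply/andP; split.
    by rewrite /t divr_gt0 ?ltr0n // mulr_gt0 ?pi_gt0 // ltr0q.
  rewrite ltr_pdivrMr ?ltr0n // ltr_pM2l ?pi_gt0 //.
  by rewrite -(ratr_nat R) ltr_rat.
by have := cos2Dsin2 t; nra.
Qed.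

End Phase.

(** * The finite groups G and B and their pairing *)
Lemma lattice_valMn (V : zmodType) (L : zmodClosed V) (a : lattice L) n :
  lattice_val (a *+ n) = lattice_val a *+ n.
Proof. exact: (raddfMn val). Qed.

Section DualGroup.
Variables (X : affine_type) (l : nat).
Local Notation P := (lattice (weight_lattice X)).
Local Notation Mo := (lattice (M_dual X)).
Local Notation k := (level X l).

(** The group B dual to G is the quotient of M^o by k Q^vee. *)
Definition level_coroot_pred : {pred Mo} := fun b =>
  `[< level_scaled k (coroot_lattice X) (val b) >].

Fact level_coroot_closed : zmod_closed level_coroot_pred.
Proof.
split; first by apply/asboolP; exists 0; rewrite ?rpred0 // mul0rn.
move=> a b /asboolP[u Mu eu] /asboolP[v Mv ev]; apply/asboolP.
by exists (u - v); rewrite ?rpredB // mulrnBl -eu -ev.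
Qed.
HB.instance Definition _ :=
  GRing.isZmodClosed.Build Mo level_coroot_pred level_coroot_closed.

Definition dual_group : zmodType := {ideal_quot level_coroot_pred}.

Definition dual_class (b : Mo) : dual_group :=
  \pi_({ideal_quot level_coroot_pred})%qT b.

Definition dual_repr (y : dual_group) : Mo := repr (y : {ideal_quot level_coroot_pred}).

Lemma dual_reprK y : dual_class (dual_repr y) = y.
Proof. exact: reprK. Qed.

Lemma dual_classD a b : dual_class (a + b) = dual_class a + dual_class b.
Proof. exact: (raddfD (\pi_({ideal_quot level_coroot_pred})%qT)). Qed.

Lemma dual_classB a b : dual_class (a - b) = dual_class a - dual_class b.
Proof. exact: (raddfB (\pi_({ideal_quot level_coroot_pred})%qT)). Qed.

Lemma dual_classP a b :
  (dual_class a == dual_class b) = (a - b \in level_coroot_pred).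
Proof. by rewrite Quotient.idealrBE. Qed.

Lemma dual_classW y : exists b, y = dual_class b.
Proof. by exists (dual_repr y); rewrite dual_reprK. Qed.

Local Notation level_class := (@level_class X l).

Lemma level_classW x : exists a, x = level_class a.
Proof. by exists (level_repr x); rewrite level_reprK. Qed.

Lemma level_classD a b : level_class (a + b) = level_class a + level_class b.
Proof. exact: (raddfD (\pi_({ideal_quot (@level_M_pred X l)})%qT)). Qed.

Lemma level_class0 : level_class 0 = 0.
Proof. exact: (raddf0 (\pi_({ideal_quot (@level_M_pred X l)})%qT)). Qed.

Lemma dual_class0 : dual_class 0 = 0.
Proof. exact: (raddf0 (\pi_({ideal_quot level_coroot_pred})%qT)). Qed.

Lemma level_class_eqP a b :
  level_class a = level_class b <-> level_scaled k (M_lattice X) (val a - val b).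
Proof.
split=> [/eqP|H]; [|apply/eqP]; rewrite level_classP.
  by move=> /asboolP.
exact/asboolP.
Qed.

Lemma dual_class_eqP a b :
  dual_class a = dual_class b <-> level_scaled k (coroot_lattice X) (val a - val b).
Proof.
split=> [/eqP|H]; [|apply/eqP]; rewrite dual_classP.
  by move=> /asboolP.
exact/asboolP.
Qed.

Hypothesis k_gt0 : (0 < k)%N.

Lemma level_group_finite : exists s : seq (level_group X l), enumerates s.
Proof.
have [b [bsep bM _ _]] := M_basis X.
have [d [N [N0 dP dN gen]]] := dual_finite_exponent (@coroot_separating X) bsep k_gt0.
apply: (enumerable_torsion (g := fun i => level_class (Lattice (dP i))) N0) => [i|x].
  rewrite -(raddfMn (\pi_({ideal_quot (@level_M_pred X l)})%qT)).
  rewrite -level_class0.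
  apply/level_class_eqP; rewrite /= subr0 lattice_valMn.
  by have [u bu e] := dN i; exists u => //; rewrite bM.
have [[v Pv] ->] := level_classW x; have [c cE] := gen v Pv; exists c.
rewrite -(eq_bigr _ (fun i _ =>
  raddfMz (\pi_({ideal_quot (@level_M_pred X l)})%qT) _ _)).
rewrite -(raddf_sum (\pi_({ideal_quot (@level_M_pred X l)})%qT)); congr level_class.
apply: val_inj; rewrite [LHS]cE raddf_sum; apply: eq_bigr => i _.
by rewrite raddfMz.
Qed.

Lemma dual_group_finite : exists s : seq dual_group, enumerates s.
Proof.
have [b [bsep bM _ _]] := M_basis X.
have [d [N [N0 dP dN gen]]] := dual_finite_exponent bsep (@coroot_separating X) k_gt0.
have dual_bM v : (v \in M_dual X) = (v \in dual_pred (span_pred b)).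
  by apply/asboolP/asboolP => h u; [rewrite -bM|rewrite bM]; exact: h.
have dM i : d i \in M_dual X by rewrite dual_bM.
apply: (enumerable_torsion (g := fun i => dual_class (Lattice (dM i))) N0) => [i|x].
  rewrite -(raddfMn (\pi_({ideal_quot level_coroot_pred})%qT)).
  rewrite -dual_class0.
  apply/dual_class_eqP; rewrite /= subr0 lattice_valMn.
  exact: dN.
have [[v Pv] ->] := dual_classW x.
have [c cE] := gen v (etrans (esym (dual_bM v)) Pv); exists c.
rewrite -(eq_bigr _ (fun i _ => raddfMz (\pi_({ideal_quot level_coroot_pred})%qT) _ _)).
rewrite -(raddf_sum (\pi_({ideal_quot level_coroot_pred})%qT)); congr dual_class.
apply: val_inj; rewrite [LHS]cE raddf_sum; apply: eq_bigr => i _.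
by rewrite raddfMz.
Qed.

End DualGroup.

Section Pairing.
Variables (R : realType) (X : affine_type) (l : nat).
Local Notation P := (lattice (weight_lattice X)).
Local Notation Mo := (lattice (M_dual X)).
Local Notation k := (level X l).
Local Notation phase := (phase R X l).
Local Notation G := (level_group X l).
Local Notation B := (dual_group X l).
Local Notation level_class := (@level_class X l).
Local Notation dual_class := (@dual_class X l).
Local Notation weylP := (weyl_act (@weight_stable X)).
Local Notation weylMo := (weyl_act (@M_dual_stable X)).
Implicit Types (x : G) (y : B) (a : P) (b : Mo).

Lemma int_level_multiple (u v : vec X) : form u v \is a Num.int ->
  level_multiple X l (form u (v *+ k)).
Proof.
by move=> /intrP[z e]; exists z; rewrite -scaler_nat formZr e mulr_natl.
Qed.

Lemma weight_coroot_int a v : v \in coroot_lattice X -> form (val a) v \is a Num.int.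
Proof. exact: (asboolW (valP a)). Qed.

Lemma M_dual_int b v : v \in M_lattice X -> form (val b) v \is a Num.int.
Proof. exact: (asboolW (valP b)). Qed.

Definition pairing y x : R[i] :=
  phase (form (val (dual_repr y)) (val (level_repr x))).

(** Well defined on classes since <M^o, M> and <Q^vee, P> consist of integers. *)
Lemma pairing_class b a :
  pairing (dual_class b) (level_class a) = phase (form (val b) (val a)).
Proof.
have /dual_class_eqP[u Qu] := dual_reprK (dual_class b).
have /level_class_eqP[v Mv] := level_reprK (level_class a).
rewrite /pairing; move: (dual_repr _) (level_repr _) => b' a' ea eb.
transitivity (phase (form (val b) (val a'))); apply: phase_cong.
  rewrite -formNl -formDl eb formC; apply: int_level_multiple.
  exact: weight_coroot_int.
rewrite -formNr -formDr ea; apply: int_level_multiple.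
exact: M_dual_int.
Qed.

Lemma pairing_neq0 y x : pairing y x != 0.
Proof. exact: phase_neq0. Qed.

Lemma pairingDl y1 y2 x : pairing (y1 + y2) x = pairing y1 x * pairing y2 x.
Proof.
have [[[b1 ->] [b2 ->]] [a ->]] := (dual_classW y1, dual_classW y2, level_classW x).
by rewrite -dual_classD !pairing_class -phaseD -formDl.
Qed.

Lemma pairingDr y x1 x2 : pairing y (x1 + x2) = pairing y x1 * pairing y x2.
Proof.
have [[[b ->] [a1 ->]] [a2 ->]] := (dual_classW y, level_classW x1, level_classW x2).
by rewrite -level_classD !pairing_class -phaseD -formDr.
Qed.

Lemma pairing0l x : pairing 0 x = 1.
Proof. by apply: (mulfI (pairing_neq0 0 x)); rewrite -pairingDl addr0 mulr1. Qed.

Lemma pairing0r y : pairing y 0 = 1.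
Proof. by apply: (mulfI (pairing_neq0 y 0)); rewrite -pairingDr addr0 mulr1. Qed.

Lemma pairingNl y x : pairing (- y) x = (pairing y x)^-1.
Proof.
apply: (mulfI (pairing_neq0 y x)).
by rewrite -pairingDl subrr pairing0l divff // pairing_neq0.
Qed.

Lemma pairingNr y x : pairing y (- x) = (pairing y x)^-1.
Proof.
apply: (mulfI (pairing_neq0 y x)).
by rewrite -pairingDr subrr pairing0r divff // pairing_neq0.
Qed.

(** M is its own double dual. *)
Lemma pairing_separates_level x : (0 < k)%N -> x != 0 -> exists y, pairing y x != 1.
Proof.
move=> k_gt0 x0; apply: contrapT => none; case/eqP: x0.
have {none} : forall y, pairing y x = 1.
  by move=> y; apply/eqP/negPn/negP => y1; apply: none; exists y.
 have [a ->] := level_classW x => a1.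
rewrite -level_class0.
apply/level_class_eqP; rewrite subr0.
have [b [bsep bM _ _]] := M_basis X.
have [u bu ->] : level_scaled k (span_pred b) (val a); last by exists u; rewrite ?bM.
apply: level_separation => // u ub.
have Mu : u \in M_dual X by apply/asboolP => v; rewrite bM; exact: (asboolW ub).
by apply: (@phase_eq1 R) => //; rewrite -(pairing_class (Lattice Mu)) a1.
Qed.

(** Q^vee is its own double dual. *)
Lemma pairing_separates_dual y : (0 < k)%N -> y != 0 -> exists x, pairing y x != 1.
Proof.
move=> k_gt0 y0; apply: contrapT => none; case/eqP: y0.
have {none} : forall x, pairing y x = 1.
  by move=> x; apply/eqP/negPn/negP => x1; apply: none; exists x.
 have [b ->] := dual_classW y => b1.
rewrite -dual_class0.
apply/dual_class_eqP; rewrite subr0.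
apply: level_separation (@coroot_separating X) _ => u Pu.
rewrite formC; apply: (@phase_eq1 R) => //.
by rewrite -(pairing_class b (Lattice Pu)) b1.
Qed.

Definition level_weyl w x : G := level_class (weylP w (level_repr x)).
Definition dual_weyl w y : B := dual_class (weylMo w (dual_repr y)).

Lemma level_weyl_class w a : level_weyl w (level_class a) = level_class (weylP w a).
Proof.
have /level_class_eqP[v Mv e] := level_reprK (level_class a).
apply/level_class_eqP; exists (weyl_mx w *m v).
  by apply: M_stable => //; apply: valP.
by rewrite /= -mulmxBr e (raddfMn (mulmx _)).
Qed.

Lemma dual_weyl_class w b : dual_weyl w (dual_class b) = dual_class (weylMo w b).
Proof.
have /dual_class_eqP[v Mv e] := dual_reprK (dual_class b).
apply/dual_class_eqP; exists (weyl_mx w *m v).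
  by apply: coroot_stable => //; apply: valP.
by rewrite /= -mulmxBr e (raddfMn (mulmx _)).
Qed.

Lemma level_weylM w1 w2 x : level_weyl (w1 * w2)%g x = level_weyl w1 (level_weyl w2 x).
Proof. by have [a ->] := level_classW x; rewrite !level_weyl_class weyl_actM. Qed.

Lemma dual_weylM w1 w2 y : dual_weyl (w1 * w2)%g y = dual_weyl w1 (dual_weyl w2 y).
Proof. by have [b ->] := dual_classW y; rewrite !dual_weyl_class weyl_actM. Qed.

Lemma level_weyl1 x : level_weyl 1%g x = x.
Proof. by have [a ->] := level_classW x; rewrite level_weyl_class weyl_act1. Qed.

Lemma dual_weyl1 y : dual_weyl 1%g y = y.
Proof. by have [b ->] := dual_classW y; rewrite dual_weyl_class weyl_act1. Qed.

Lemma level_weylD w x1 x2 : level_weyl w (x1 + x2) = level_weyl w x1 + level_weyl w x2.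
Proof.
have [[a1 ->] [a2 ->]] := (level_classW x1, level_classW x2).
by rewrite -level_classD !level_weyl_class weyl_actD level_classD.
Qed.

Lemma level_weylK w : cancel (level_weyl w) (level_weyl w^-1%g).
Proof. by move=> x; rewrite -level_weylM mulVg level_weyl1. Qed.

Lemma level_weylVK w : cancel (level_weyl w^-1%g) (level_weyl w).
Proof. by move=> x; rewrite -level_weylM mulgV level_weyl1. Qed.

Lemma dual_weylK w : cancel (dual_weyl w) (dual_weyl w^-1%g).
Proof. by move=> y; rewrite -dual_weylM mulVg dual_weyl1. Qed.

Lemma dual_weylVK w : cancel (dual_weyl w^-1%g) (dual_weyl w).
Proof. by move=> y; rewrite -dual_weylM mulgV dual_weyl1. Qed.

Lemma pairing_weyl w y x : pairing (dual_weyl w y) (level_weyl w x) = pairing y x.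
Proof.
have [[b ->] [a ->]] := (dual_classW y, level_classW x).
by rewrite level_weyl_class dual_weyl_class !pairing_class /= (weyl_form _ _ (valP w)).
Qed.

End Pairing.

(** * The operators of the double affine Weyl group *)
Lemma linear_additive (K : pzRingType) (U V : lmodType K) (A : U -> V) :
  linear A -> {morph A : f g / f + g}.
Proof. by move=> linA f g; rewrite -[f in LHS]scale1r linA scale1r. Qed.

Lemma linear_zero (K : pzRingType) (U V : lmodType K) (A : U -> V) :
  linear A -> A 0 = 0.
Proof. by move=> /linear_additive AD; apply: (addrI (A 0)); rewrite -AD !addr0. Qed.

Lemma linear_scale (K : pzRingType) (U V : lmodType K) (A : U -> V) :
  linear A -> forall c f, A (c *: f) = c *: A f.
Proof. by move=> linA c f; rewrite -[_ *: f]addr0 linA linear_zero // addr0. Qed.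

Section Representation.
Variables (R : realType) (X : affine_type) (l : nat) (m : denominator X).
Local Notation P := (lattice (weight_lattice X)).
Local Notation Mo := (lattice (M_dual X)).
Local Notation k := (level X l).
Local Notation phase := (phase R X l).
Local Notation G := (level_group X l).
Local Notation B := (dual_group X l).
Local Notation level_class := (@level_class X l).
Local Notation dual_class := (@dual_class X l).
Local Notation pairing := (@pairing R X l).
Local Notation trunc_poly := (trunc_poly R X l).
Implicit Types (x : G) (y : B) (a : P) (b : Mo) (f : trunc_poly).
Implicit Types (h : heis m) (w : weyl_group X).

Definition heis_phase h : R[i] :=
  phase (val (heis_u h) + form (val (heis_t h)) (val (heis_p h)) / 2).

(** The operator of h = (alpha, beta, u), with the character <beta, .> read through
    the pairing of B and G instead of through representatives. *)
Definition heis_op h f : trunc_poly := fun x =>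
  heis_phase h * (pairing (dual_class (heis_p h)) (x - level_class (heis_t h))
    * f (x - level_class (heis_t h))).

Lemma op_wE w f x : op_w w f x = f (level_weyl w^-1%g x).
Proof. by []. Qed.

Lemma pairing_dual_class b x :
  pairing (dual_class b) x = phase (form (val b) (val (level_repr x))).
Proof. by rewrite -[x in LHS]level_reprK pairing_class. Qed.

Lemma trunc_repE w h f : @trunc_rep R X l m (w, h) f = op_w w (heis_op h f).
Proof.
rewrite /trunc_rep; congr (op_w w _); apply/funext => x.
by rewrite /heis_op pairing_dual_class mulrCA.
Qed.

Lemma op_wM w1 w2 f : op_w w1 (op_w w2 f) = op_w (w1 * w2)%g f.
Proof. by apply/funext => x; rewrite !op_wE invgM level_weylM. Qed.

Lemma heis_opM h1 h2 f : heis_op h1 (heis_op h2 f) = heis_op (h1 * h2)%g f.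
Proof.
apply/funext => x; rewrite /heis_op /heis_phase.
case: h1 h2 => [a1 b1 u1] [a2 b2 u2] /=.
rewrite level_classD opprD addrA; move: (x - _) => y.
rewrite -{1}(subrK (level_class a2) y).
have [c ->] := level_classW (y - level_class a2).
rewrite -level_classD !pairing_class !mulrA; congr (_ * _).
rewrite -!phaseD; congr phase; rewrite /= !(formDl, formDr).
by rewrite (formC (val b1) (val a2)); field.
Qed.

Lemma heis_op_weyl h w f : heis_op h (op_w w f) = op_w w (heis_op (heis_weyl h w) f).
Proof.
apply/funext => x; rewrite op_wE /heis_op op_wE.
have -> : heis_phase (heis_weyl h w) = heis_phase h.
  by rewrite /heis_phase /= (weyl_form _ _ (valP w^-1%g)).
rewrite /= -level_weyl_class.
have wB z1 z2 :
    level_weyl w^-1%g (z1 - z2) = level_weyl w^-1%g z1 - level_weyl w^-1%g z2.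
  by apply: (addIr (level_weyl w^-1%g z2)); rewrite -level_weylD !subrK.
by rewrite -!wB -dual_weyl_class pairing_weyl.
Qed.

Lemma trunc_repM (p q : double_affine_weyl m) f :
  trunc_rep p (trunc_rep q f) = trunc_rep (p * q)%g f.
Proof.
case: p q => [w1 h1] [w2 h2]; rewrite !trunc_repE heis_op_weyl op_wM heis_opM.
by [].
Qed.

Lemma op_w1 f : op_w 1%g f = f.
Proof. by apply/funext => x; rewrite op_wE invg1 level_weyl1. Qed.

Lemma heis_op1 f : heis_op 1%g f = f.
Proof.
apply/funext => x; rewrite /heis_op /heis_phase /= form0l mul0r addr0 phase0.
by rewrite level_class0 dual_class0 subr0 pairing0l !mul1r.
Qed.

Lemma trunc_rep1 f : trunc_rep (1%g : double_affine_weyl m) f = f.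
Proof. by apply: etrans (trunc_repE 1%g 1%g f) _; rewrite op_w1 heis_op1. Qed.

Lemma trunc_polyE c f g x : (c *: f + g) x = c * f x + g x.
Proof. by []. Qed.

Lemma trunc_rep_linear (p : double_affine_weyl m) : linear (@trunc_rep R X l m p).
Proof.
case: p => w h c f g; rewrite !trunc_repE; apply/funext => x.
by rewrite trunc_polyE !op_wE /heis_op trunc_polyE; ring.
Qed.

Lemma trunc_rep_level (p : double_affine_weyl m) f :
  level_subgroup l p -> trunc_rep p f = f.
Proof.
case: p => w [a b u] [/= -> [v Mv av] [v' Qv bv] [z uz]].
apply: etrans (trunc_repE 1%g (Heis a b u) f) _; rewrite op_w1.
have a0 : level_class a = 0.
  rewrite -level_class0.
  by apply/level_class_eqP; rewrite subr0; exists v.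
have b0 : dual_class b = 0.
  rewrite -dual_class0.
  by apply/dual_class_eqP; rewrite subr0; exists v'.
apply/funext => x; rewrite /heis_op /heis_phase /= a0 b0 subr0 pairing0l mul1r uz.
by rewrite phase_level mul1r.
Qed.

End Representation.

(** * Finite Fourier transform and irreducibility *)
Section FiniteFourier.
Variables (R : realType) (X : affine_type) (l : nat) (m : denominator X).
Local Notation P := (lattice (weight_lattice X)).
Local Notation Mo := (lattice (M_dual X)).
Local Notation k := (level X l).
Local Notation phase := (phase R X l).
Local Notation G := (level_group X l).
Local Notation B := (dual_group X l).
Local Notation level_class := (@level_class X l).
Local Notation dual_class := (@dual_class X l).
Local Notation pairing := (@pairing R X l).
Local Notation trunc_poly := (trunc_poly R X l).
Implicit Types (x : G) (y : B) (a : P) (b : Mo) (f : trunc_poly).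
Implicit Types (h : heis m) (w : weyl_group X).
Implicit Types (v : B -> R[i]).

Hypothesis k_gt0 : (0 < k)%N.
Variables (sG : seq G) (sB : seq B).
Hypotheses (sG_all : enumerates sG) (sB_all : enumerates sB).

Definition fourier f : B -> R[i] := fun y => \sum_(x <- sG) (pairing y x)^-1 * f x.
Definition fourier_back v : trunc_poly := fun x => \sum_(y <- sB) pairing y x * v y.

(** Fourier inversion: B separates the points of G, so a character of B that comes
    from a nonzero x - x' is nontrivial and sums to 0. *)
Lemma fourierK f x : fourier_back (fourier f) x = (size sB)%:R * f x.
Proof.
rewrite /fourier_back /fourier; under eq_bigr => y _ do rewrite mulr_sumr.
rewrite exchange_big (sum_indicator sG_all (x := x)) /= => [|x' ne].
  under eq_bigr => y _ do rewrite mulrA divff ?pairing_neq0 // mul1r.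
  by rewrite big_const_seq count_predT iter_addr_0 mulr_natl.
have [y yx] : exists y, pairing y (x - x') != 1.
  by apply: pairing_separates_level; rewrite // subr_eq0 eq_sym.
under eq_bigr => y' _ do rewrite mulrA -pairingNr -pairingDr.
rewrite -mulr_suml (sum_character sB_all _ yx) ?mul0r // => y1 y2.
exact: pairingDl.
Qed.

Lemma fourierVK v y : fourier (fourier_back v) y = (size sG)%:R * v y.
Proof.
rewrite /fourier_back /fourier; under eq_bigr => x _ do rewrite mulr_sumr.
rewrite exchange_big (sum_indicator sB_all (x := y)) /= => [|y' ne].
  under eq_bigr => x _ do rewrite mulrA mulVf ?pairing_neq0 // mul1r.
  by rewrite big_const_seq count_predT iter_addr_0 mulr_natl.
have [x xy] : exists x, pairing (y' - y) x != 1.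
  by apply: pairing_separates_dual; rewrite // subr_eq0.
under eq_bigr => x' _ do rewrite mulrA [_^-1 * _]mulrC -pairingNl -pairingDl.
rewrite -mulr_suml (sum_character sG_all _ xy) ?mul0r // => x1 x2.
exact: pairingDr.
Qed.

Lemma size_sB_neq0 : (size sB)%:R != 0 :> R[i].
Proof.
rewrite pnatr_eq0 size_eq0; apply/eqP => e.
by have := sB_all.2 0; rewrite e.
Qed.

Lemma size_sG_neq0 : (size sG)%:R != 0 :> R[i].
Proof.
rewrite pnatr_eq0 size_eq0; apply/eqP => e.
by have := sG_all.2 0; rewrite e.
Qed.

(** The Fourier transform of [heis_op]: alpha now multiplies by a character of B and
    beta translates. *)
Definition dual_heis_op h v : B -> R[i] := fun y =>
  heis_phase R l h *
    ((pairing y (level_class (heis_t h)))^-1 * v (y - dual_class (heis_p h))).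

Lemma fourier_heis h f : fourier (heis_op h f) = dual_heis_op h (fourier f).
Proof.
apply/funext => y; rewrite /fourier /dual_heis_op /heis_op.
rewrite -(sum_reindex sG_all _ (addrK (level_class (heis_t h))) (subrK _)).
rewrite !mulr_sumr; apply: eq_bigr => x _.
rewrite addrK pairingDr pairingDl pairingNl.
by field; rewrite !pairing_neq0.
Qed.

Lemma fourier_back_heis h v :
  fourier_back (dual_heis_op h v) = heis_op h (fourier_back v).
Proof.
apply/funext => x; rewrite /fourier_back /dual_heis_op /heis_op.
rewrite -(sum_reindex sB_all _ (addrK (dual_class (heis_p h))) (subrK _)).
rewrite !mulr_sumr; apply: eq_bigr => y _.
rewrite addrK !pairingDl !pairingDr !pairingNr.
by field; rewrite !pairing_neq0.
Qed.

Lemma fourier_weyl w f y : fourier (op_w w f) y = fourier f (dual_weyl w^-1%g y).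
Proof.
rewrite /fourier -(sum_reindex sG_all _ (level_weylK w) (level_weylVK w)).
apply: eq_bigr => x _; rewrite op_wE level_weylK -{1}[y](dual_weylVK w).
by rewrite pairing_weyl.
Qed.

Lemma fourier_back_weyl w v :
  fourier_back (fun y => v (dual_weyl w^-1%g y)) = op_w w (fourier_back v).
Proof.
apply/funext => x; rewrite op_wE /fourier_back.
rewrite -(sum_reindex sB_all _ (dual_weylK w) (dual_weylVK w)).
apply: eq_bigr => y _; rewrite dual_weylK -{1}[x](level_weylVK w).
by rewrite pairing_weyl.
Qed.

Definition delta (z : G) : trunc_poly := fun x => (x == z)%:R.

Lemma delta_sum f : f = \sum_(z <- sG) f z *: delta z.
Proof.
apply/funext => x.
rewrite -[RHS]/((\sum_(z <- sG) f z *: delta z : G -> R[i]^o) x) fct_sumE.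
rewrite (sum_indicator sG_all (x := x)) => [|z ne].
  by rewrite -[RHS]/(f x * (x == x)%:R) eqxx mulr1.
by rewrite -[LHS]/(f z * (x == z)%:R) eq_sym (negPf ne) mulr0.
Qed.

Lemma heis_op_p b f x :
  heis_op (Heis 0 b 0 : heis m) f x = pairing (dual_class b) x * f x.
Proof.
by rewrite /heis_op /heis_phase /= form0l mul0r addr0 phase0 level_class0 subr0 mul1r.
Qed.

Lemma heis_op_t a f x : heis_op (Heis a 0 0 : heis m) f x = f (x - level_class a).
Proof.
rewrite /heis_op /heis_phase /= form0r mul0r addr0 phase0 dual_class0.
by rewrite pairing0l !mul1r.
Qed.

(** The functions supported at 0 are those fixed by all multiplication operators
    p_beta, because B separates the points of G; so C maps [delta 0] to a multiple
    of itself, and the translations carry this to every [delta z]. *)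
Lemma commutant_scalar (C : trunc_poly -> trunc_poly) : linear C ->
  (forall h f, C (heis_op h f) = heis_op h (C f)) ->
  exists c : R[i], forall f, C f = c *: f.
Proof.
move=> linC comm; pose c := C (delta 0) 0.
have delta0 z : z != 0 -> C (delta 0) z = 0.
  move=> z0; have [y yz] := pairing_separates_level R k_gt0 z0.
  have [b yb] := dual_classW y; rewrite {}yb in yz.
  have db : heis_op (Heis 0 b 0 : heis m) (delta 0) = delta 0.
    apply/funext => x; rewrite heis_op_p /delta; case: eqVneq => [->|_].
      by rewrite pairing0r mul1r.
    by rewrite mulr0.
  have := congr1 (fun f : trunc_poly => f z) (comm (Heis 0 b 0 : heis m) (delta 0)).
  rewrite db heis_op_p => e; apply/eqP; move: e => /eqP.
  rewrite -subr_eq0 -{1}[C _ z]mul1r -mulrBl mulf_eq0 subr_eq0 eq_sym (negPf yz).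
  by [].
have deltaE z : C (delta z) = c *: delta z.
  have [a ->] := level_classW z.
  have -> : delta (level_class a) = heis_op (Heis a 0 0 : heis m) (delta 0).
    by apply/funext => x; rewrite heis_op_t /delta subr_eq0.
  rewrite comm; apply/funext => x; rewrite -[RHS]/(c * _) !heis_op_t /delta.
  by case: eqVneq => [->|/delta0 ->]; rewrite ?mulr1 ?mulr0.
exists c => f; rewrite {1}(delta_sum f) [RHS](congr1 _ (delta_sum f)).
rewrite (big_morph C (linear_additive linC) (linear_zero linC)) scaler_sumr.
by apply: eq_bigr => z _; rewrite (linear_scale linC) deltaE !scalerA mulrC.
Qed.

End FiniteFourier.

(** * Gaussians on G and B *)

(** Here M^o is the weight lattice, which is contained in Q^vee. *)
Lemma A2even_M_dual_int X (u v : vec X) : is_A2even X ->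
  u \in M_dual X -> v \in M_dual X -> form u v \is a Num.int.
Proof.
case: X u v => // p u v _ uP /A2even_weight_sub_coroot vQ.
exact: (asboolW uP).
Qed.

Lemma M_half_form_int X (t : rat) (v : vec X) : v \in M_lattice X ->
  t \is a Num.int -> (is_A2even X -> t / 2 \is a Num.int) ->
  t * form v v / 2 \is a Num.int.
Proof.
have [b [_ bM bint beven]] := M_basis X; rewrite bM => vb tint teven.
apply: half_form_int vb => [i j|i]; first by rewrite rpredM.
have [/teven t2|/beven b2] := boolP (is_A2even X).
  by rewrite mulrAC rpredM ?bint.
by rewrite -mulrA rpredM ?b2.
Qed.

Section Gauss.
Variables (R : realType) (X : affine_type) (l : nat).
Local Notation P := (lattice (weight_lattice X)).
Local Notation Mo := (lattice (M_dual X)).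
Local Notation k := (level X l).
Local Notation phase := (phase R X l).
Local Notation G := (level_group X l).
Local Notation B := (dual_group X l).
Local Notation level_class := (@level_class X l).
Local Notation dual_class := (@dual_class X l).
Implicit Types (x : G) (y : B) (a : P) (b : Mo) (n : int).

(** The exceptional case, in which <lambda, lambda>/2 is not a quadratic form modulo k
    on P/kM and gets multiplied by k + 1. *)
Definition odd_twist : nat := is_A2even X && odd k.

Definition level_gauss n x : R[i] :=
  phase (- (n%:~R * (1 + odd_twist * k)%:R / 2
            * form (val (level_repr x)) (val (level_repr x)))).

Lemma int_multiple (u : rat) : u \is a Num.int -> level_multiple X l (k%:R * u).
Proof. by move=> /intrP[z ->]; exists z; rewrite mulr_natl. Qed.

(** Moving a by k v changes the exponent by multiples of k: s <a, v> and
    s k <v, v>/2 are integers, s being k + 1 in the exceptional case and 1 otherwise. *)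
Lemma level_gauss_class n a :
  level_gauss n (level_class a) =
    phase (- (n%:~R * (1 + odd_twist * k)%:R / 2 * form (val a) (val a))).
Proof.
have /level_class_eqP[v Mv] := level_reprK (level_class a).
rewrite /level_gauss; move: (level_repr _) => a' /eqP; rewrite subr_eq => /eqP ->.
apply: phase_cong; set s := (1 + _)%N.
have av : form (val a) v \is a Num.int.
  exact: M_dual_int (Lattice (weight_sub_M_dual (valP a))) v Mv.
have vv : (s * k)%:R * form v v / 2 \is a Num.int.
  apply: M_half_form_int => //.
  move=> A; apply: dvdn_ratio_int; rewrite dvdn2 oddM /s /odd_twist A /=.
  by case: (boolP (odd k)) => //= ok; rewrite mul1n /= ok.
rewrite (_ : _ - _ =
    k%:R * (- n%:~R * (s%:R * form (val a) v + (s * k)%:R * form v v / 2))).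
  apply: int_multiple; rewrite rpredM ?rpredN ?intr_int // rpredD //.
  by rewrite rpredM ?natr_int.
rewrite !(formDl, formDr) -!scaler_nat !(formZl, formZr) (formC v) natrM.
by field.
Qed.

Lemma level_gaussN n x : level_gauss n x * level_gauss (- n) x = 1.
Proof. by rewrite /level_gauss -phaseD -opprD mulrNz !mulNr subrr oppr0 phase0. Qed.

Lemma level_gauss_weyl n w x : level_gauss n (level_weyl w x) = level_gauss n x.
Proof.
have [a ->] := level_classW x; rewrite level_weyl_class !level_gauss_class /=.
by rewrite (weyl_form _ _ (valP w)).
Qed.

Definition dual_gauss n y : R[i] :=
  phase (n%:~R * (tier X)%:R / 2 * form (val (dual_repr y)) (val (dual_repr y))).

(** Moving b by k v with v in Q^vee changes the exponent by multiples of k, because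
    r M^o is contained in P and r <v, v>/2 is an integer. *)
Lemma dual_gauss_class n b :
  dual_gauss n (dual_class b) = phase (n%:~R * (tier X)%:R / 2 * form (val b) (val b)).
Proof.
have /dual_class_eqP[v Qv] := dual_reprK (dual_class b).
rewrite /dual_gauss; move: (dual_repr _) => b' /eqP; rewrite subr_eq => /eqP ->.
apply: phase_cong; set r := (tier X)%:R.
have bv : r * form (val b) v \is a Num.int.
  rewrite /r pmulrn -formMzl; exact: (asboolW (tier_M_dual_sub_weight (valP b))).
have vv := coroot_even Qv; rewrite -/r in vv.
rewrite (_ : _ - _ = k%:R * (n%:~R * (r * form (val b) v + k%:R * (r * form v v / 2)))).
  by apply: int_multiple; rewrite rpredM ?intr_int // rpredD // rpredM ?natr_int.
rewrite !(formDl, formDr) -!scaler_nat !(formZl, formZr) (formC v).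
by field.
Qed.

Lemma dual_gaussN n y : dual_gauss n y * dual_gauss (- n) y = 1.
Proof. by rewrite /dual_gauss -phaseD mulrNz !mulNr subrr phase0. Qed.

Lemma dual_gauss_weyl n w y : dual_gauss n (dual_weyl w y) = dual_gauss n y.
Proof.
have [b ->] := dual_classW y; rewrite dual_weyl_class !dual_gauss_class /=.
by rewrite (weyl_form _ _ (valP w)).
Qed.

End Gauss.

(** * Operators intertwining the action of Gamma_1(r) *)
Section Intertwiners.
Variables (R : realType) (X : affine_type) (l : nat) (m : denominator X).
Local Notation P := (lattice (weight_lattice X)).
Local Notation Mo := (lattice (M_dual X)).
Local Notation k := (level X l).
Local Notation phase := (phase R X l).
Local Notation G := (level_group X l).
Local Notation B := (dual_group X l).
Local Notation level_class := (@level_class X l).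
Local Notation dual_class := (@dual_class X l).
Local Notation pairing := (@pairing R X l).
Local Notation trunc_poly := (trunc_poly R X l).
Local Notation Gamma := (Gamma1 (tier X)).
Local Notation twist := (odd_twist X l).
Implicit Types (x : G) (y : B) (a : P) (b : Mo) (f : trunc_poly).
Implicit Types (h : heis m) (w : weyl_group X).
Implicit Types (g : Gamma) (A : trunc_poly -> trunc_poly).

(** The phase of this exponent is the character chi_g. *)
Definition twist_exponent g h : rat :=
  - ((twist * k)%:R * (g 0 1)%:~R / 2 * form (val (heis_t h)) (val (heis_t h))).

Definition intertwines A g := [/\ linear A,
  forall w f, A (op_w w f) = op_w w (A f) &
  forall h f,
    A (heis_op (heis_gamma h g) f) = phase (twist_exponent g h) *: heis_op h (A f)].

Definition invertible_intertwiner g := exists A A',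
  [/\ intertwines A g, cancel A A' & cancel A' A].

Lemma odd_twist_multiple (n : rat) : (is_A2even X -> odd k -> n \is a Num.int) ->
  level_multiple X l ((twist * k)%:R * n).
Proof.
have zero : level_multiple X l ((0 * k)%N%:R * n).
  by rewrite mul0r; exists 0; rewrite mul0rn.
rewrite /odd_twist; case: (is_A2even X) => //.
case: (odd k) => // /(_ isT isT) nint.
by rewrite mul1n; exact: int_multiple.
Qed.

(** In the exceptional case the exponents differ by k times the number q below, and
    q is an integer: there r = 2, so that g1 and g2 have odd diagonal entries and
    even lower left entries, and the form is integral on M^o. *)
Lemma twist_cocycle g1 g2 h : phase (twist_exponent (g1 * g2)%g h) =
  phase (twist_exponent g1 h) * phase (twist_exponent g2 (heis_gamma h g1)).
Proof.
case: h => a b u; rewrite -phaseD; apply: phase_cong.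
rewrite /twist_exponent /= mulmx2.
set a1 := g1 0 0; set b1 := g1 0 1; set c1 := g1 1 0.
set b2 := g2 0 1; set d2 := g2 1 1.
pose q := b2%:~R * (a1 * (a1 - 1))%:~R / 2 * form (val a) (val a)
  - b1%:~R * (d2 - 1)%:~R / 2 * form (val a) (val a)
  + b2%:~R * (a1 * c1)%:~R * form (val a) (val b)
  + b2%:~R * (c1 * c1)%:~R / 2 * form (val b) (val b) : rat.
rewrite (_ : _ - _ = (twist * k)%:R * q).
  apply: odd_twist_multiple => A _.
  have aM : val a \in M_dual X by exact/weight_sub_M_dual/valP.
  have [aa ab bb] : [/\ form (val a) (val a) \is a Num.int,
      form (val a) (val b) \is a Num.int
      & form (val b) (val b) \is a Num.int].
    by split; apply: A2even_M_dual_int => //; exact: valP.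
  have r2 : tier X = 2%N by move: A; case: (X).
  have /and4P[_ /dvdzP[i ai] /dvdzP[j cj] _] := valP g1.
  have /and4P[_ _ _ /dvdzP[t dt]] := valP g2.
  have rz : (tier X)%:Z = 2 by rewrite r2.
  rewrite rz in ai cj dt.
  rewrite (_ : q = (b2 * (a1 * i) - b1 * t)%:~R * form (val a) (val a)
    + (b2 * (a1 * c1))%:~R * form (val a) (val b)
    + (b2 * (j * j) * 2)%:~R * form (val b) (val b)).
    by rewrite !rpredD // rpredM ?intr_int.
  rewrite /q [a1 - 1]ai [d2 - 1]dt {2 3}[c1]cj !(intrM, intrB).
  by field.
rewrite !(formDl, formDr, formMzl, formMzr) (formC (val b) (val a)) /q.
rewrite !(intrD, intrM, intrB) ?intrN.
by field.
Qed.

Lemma intertwinesM A1 A2 g1 g2 : intertwines A1 g1 -> intertwines A2 g2 ->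
  intertwines (fun f => A1 (A2 f)) (g1 * g2)%g.
Proof.
move=> [lin1 w1 t1] [lin2 w2 t2]; split=> [c f f'|w f|h f].
- by rewrite lin2 lin1.
- by rewrite w2 w1.
- by rewrite heis_gammaM t2 (linear_scale lin1) t1 scalerA twist_cocycle mulrC.
Qed.

Lemma invertible_intertwinerM g1 g2 : invertible_intertwiner g1 ->
  invertible_intertwiner g2 -> invertible_intertwiner (g1 * g2)%g.
Proof.
move=> [A1 [B1 [I1 K1 VK1]]] [A2 [B2 [I2 K2 VK2]]].
exists (fun f => A1 (A2 f)), (fun f => B2 (B1 f)); split.
- exact: intertwinesM.
- by move=> f; rewrite K1 K2.
- by move=> f; rewrite VK2 VK1.
Qed.

(** By polarization, the Gaussian at c + a is the product of those at c and a and of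
    the character -n <a, .>, which T(h . g) cancels: there alpha = a is unchanged and
    beta is increased by n a.  The factor k + 1 of the exceptional case contributes
    multiples of k and the value chi_g(h). *)
Lemma intertwiner_upper n : invertible_intertwiner (upper (tier X) n).
Proof.
pose D n' f : trunc_poly := fun x => level_gauss R n' x * f x.
have DK n' : cancel (D n') (D (- n')).
  move=> f; apply/funext => x; rewrite /D mulrA.
  by rewrite [level_gauss R (- n') x * _]mulrC level_gaussN mul1r.
exists (D n), (D (- n)); split; [|exact (DK n)|by move=> f; rewrite -{1}(opprK n) DK].
split=> [c f f'|w f|h f]; apply/funext => x.
- by rewrite trunc_polyE /D trunc_polyE; ring.
- by rewrite op_wE /D op_wE level_gauss_weyl.
rewrite -[RHS]/(_ * _) /D /heis_op.
have [e0 e1 e2 e3] := mx2_entries 1 n 0 1.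
case: h => a b u; set g := upper _ _; set h' := heis_gamma _ _.
have -> : heis_t h' = a by apply: val_inj; rewrite /= e0 e2 mulr1z mulr0z addr0.
rewrite -{1}(subrK (level_class a) x) /=.
have [c ->] := level_classW (x - level_class a).
rewrite -level_classD !level_gauss_class !pairing_class !mulrA -!phaseD.
congr (_ * _); apply: phase_cong.
rewrite (_ : _ - _ = (twist * k)%:R * (- n%:~R * form (val a) (val c))).
  apply: odd_twist_multiple => A _; rewrite rpredM ?rpredN ?intr_int //.
  by apply: A2even_M_dual_int; rewrite // weight_sub_M_dual ?(valP a) ?(valP c).
rewrite /twist_exponent /= e0 e1 e2 e3 !(mulr1z, mulr0z) addr0.
rewrite !(formDl, formDr, formMzl, formMzr) (formC (val c) (val a)) natrD.
by field.
Qed.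

Lemma phase_twist0 g h : g 0 1 = 0 -> phase (twist_exponent g h) = 1.
Proof. by rewrite /twist_exponent => ->; rewrite mulr0 !mul0r oppr0 phase0. Qed.

Lemma intertwiner_opposite g :
  g 0 0 = -1 -> g 0 1 = 0 -> g 1 0 = 0 -> g 1 1 = -1 -> invertible_intertwiner g.
Proof.
move=> e0 e1 e2 e3; pose N f : trunc_poly := fun x => f (- x).
have NK : cancel N N by move=> f; apply/funext => x; rewrite /N opprK.
exists N, N; split=> //; split=> [//|w f|h f]; apply/funext => x.
  rewrite op_wE /N op_wE; congr f.
  by apply: (addIr (level_weyl w^-1%g x)); rewrite -level_weylD !addNr -level_class0
    level_weyl_class; congr level_class; apply: val_inj; rewrite /= mulmx0.
rewrite phase_twist0 // scale1r /N /heis_op.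
case: h => a b u; set h' := heis_gamma _ _.
have -> : heis_t h' = - a.
  by apply: val_inj; rewrite /= e0 e2 mulrNz mulr1z mulr0z addr0.
have pb : heis_p h' = - b.
  by apply: val_inj; rewrite /= e1 e3 mulrNz mulr1z mulr0z add0r.
rewrite pb (_ : heis_phase _ _ h' = heis_phase R l (Heis a b u)); last first.
  rewrite /heis_phase /= e0 e1 e2 e3 !mulrNz !mulr1z !mulr0z addr0 add0r.
  by rewrite formNl formNr opprK.
have opL : level_class (- a) = - level_class a.
  by rewrite -[- a]add0r level_classB level_class0 add0r.
have opD : dual_class (- b) = - dual_class b.
  by rewrite -[- b]add0r dual_classB dual_class0 add0r.
by rewrite opL opD -opprD pairingNl pairingNr invrK.
Qed.

Hypothesis k_gt0 : (0 < k)%N.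

(** On B the roles of alpha and beta are exchanged: beta is unchanged and alpha is
    increased by n r beta, so multiplication by the Gaussian of B intertwines the
    Fourier transforms of the two actions. *)
Lemma intertwiner_lower n : invertible_intertwiner (lower (tier X) n).
Proof.
have [sG sG_all] := level_group_finite k_gt0.
have [sB sB_all] := dual_group_finite k_gt0.
pose F f := fourier sG f; pose F' v := fourier_back sB v : trunc_poly.
pose E n' f : trunc_poly := F' (fun y => dual_gauss R n' y * F f y).
pose C : R[i] := (size sB)%:R * (size sG)%:R.
have C0 : C != 0 by rewrite mulf_neq0 ?(size_sB_neq0 _ sB_all) ?(size_sG_neq0 _ sG_all).
have linF c f f' y : F (c *: f + f') y = c * F f y + F f' y.
  rewrite /F /fourier mulr_sumr -big_split; apply: eq_bigr => x _ /=.
  by rewrite trunc_polyE; ring.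
have linE n' : linear (E n').
  move=> c f f'; apply/funext => x; rewrite trunc_polyE /E /F' /fourier_back.
  rewrite mulr_sumr -big_split; apply: eq_bigr => y _ /=; rewrite linF; ring.
have EE n' f : E (- n') (E n' f) = C *: f.
  apply/funext => x; rewrite -[RHS]/(C * f x).
  rewrite /C [_ * (size sG)%:R]mulrC -mulrA -(fourierK k_gt0 sG_all sB_all).
  rewrite /E /F' /fourier_back mulr_sumr.
  apply: eq_bigr => y _; rewrite /F (fourierVK k_gt0 sG_all sB_all).
  by rewrite -[RHS]mul1r -(dual_gaussN R n' y); ring.
exists (E n), (fun f => C^-1 *: E (- n) f); split; last 2 first.
- by move=> f; rewrite EE scalerA mulVf ?scale1r.
- by move=> f; rewrite (linear_scale (linE n)) -{1}(opprK n) EE scalerA mulVf ?scale1r.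
split=> // [w f|h f].
  rewrite /E /F' /F -fourier_back_weyl //; congr fourier_back; apply/funext => y.
  by rewrite fourier_weyl // dual_gauss_weyl.
have [e0 e1 e2 e3] := mx2_entries 1 0 ((tier X)%:Z * n) 1.
rewrite phase_twist0 // scale1r /E /F' /F -fourier_back_heis // fourier_heis //.
congr fourier_back; apply/funext => y; rewrite /dual_heis_op.
case: h => a b u; set g := lower _ _; set h' := heis_gamma _ _.
have -> : heis_p h' = b by apply: val_inj; rewrite /= e1 e3 mulr1z mulr0z add0r.
have [d dE] := dual_classW (y - dual_class b).
have yE : y = dual_class (d + b) by rewrite dual_classD -dE subrK.
rewrite dE yE !dual_gauss_class !pairing_class /heis_phase -!phaseN !mulrA -!phaseD.
congr (phase _ * _).
rewrite /= e0 e1 e2 e3 !(mulr1z, mulr0z) add0r.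
rewrite !(formDl, formDr, formMzl, formMzr) (formC (val b) (val d)) intrM -pmulrn.
by field.
Qed.

Lemma invertible_intertwiners g : invertible_intertwiner g.
Proof.
apply: Gamma1_ind g.
- by case: (X) => [p|p|p|p||||||p|p|p||].
- exact: intertwiner_upper.
- exact: intertwiner_lower.
- exact: intertwiner_opposite.
- exact: invertible_intertwinerM.
Qed.

(** A_2^-1 A_1 commutes with the operators of all h . g, and every element of the
    Heisenberg group has this form. *)
Lemma intertwiner_unique A1 A2 B2 g : intertwines A1 g -> intertwines A2 g ->
  cancel A2 B2 -> cancel B2 A2 -> exists c : R[i], forall f, A1 f = c *: A2 f.
Proof.
move=> [lin1 _ t1] [lin2 _ t2] K2 VK2.
have [sG sG_all] := level_group_finite k_gt0.
have linB2 : linear B2.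
  by move=> c f f'; rewrite -{1}(VK2 f) -{1}(VK2 f') -lin2 K2.
have [c cE] : exists c : R[i], forall f, B2 (A1 f) = c *: f.
  apply: (commutant_scalar (m := m) k_gt0 sG_all (C := fun f => B2 (A1 f))).
    move=> c f f'.
    by rewrite lin1 linB2.
  move=> h f; have -> : h = heis_gamma (heis_gamma h g^-1%g) g.
    by rewrite -heis_gammaM mulVg heis_gamma1.
  by apply: (can_inj K2); rewrite VK2 t1 t2 VK2.
by exists c => f; rewrite -[A1 f]VK2 -(linear_scale lin2) cE.
Qed.

End Intertwiners.

(** * The projective representation *)
Definition linear_pack (K : pzRingType) (U V : lmodType K) (A : U -> V)
    (linA : linear A) : {linear U -> V} :=
  HB.pack A (GRing.isLinear.Build K U V _ A linA).

Section MainTheorem.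
Variables (R : realType) (X : affine_type) (l : nat) (m : denominator X).
Local Notation tp := (trunc_poly R X l).
Local Notation Gamma := (Gamma1 (tier X)).
Implicit Types (f : tp) (g : Gamma).
Hypothesis k_gt0 : (0 < level X l)%N.

Lemma intertwiner_one : intertwines m (fun f : tp => f) 1%g.
Proof.
split=> // h f; rewrite phase_twist0 ?scale1r; last by rewrite /= mxE.
by congr heis_op; exact: heis_gamma1.
Qed.

(** The choice A_1 = 1 makes the representation extend that of the double affine
    Weyl group without a scalar. *)
Lemma intertwiner_family : exists A B : Gamma -> tp -> tp,
  [/\ forall g, intertwines m (A g) g, forall g, cancel (A g) (B g),
      forall g, cancel (B g) (A g) & forall f, A 1%g f = f].
Proof.
have /choice[AB AB_P] g : exists AB : (tp -> tp) * (tp -> tp),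
    [/\ intertwines m AB.1 g, cancel AB.1 AB.2, cancel AB.2 AB.1
      & g = 1%g -> forall f, AB.1 f = f].
  have [->|g1] := eqVneq g 1%g.
    by exists (id, id); split=> //; exact: intertwiner_one.
  have [A [B [Ag K VK]]] := invertible_intertwiners R m k_gt0 g.
  by exists (A, B); split=> // e; rewrite e eqxx in g1.
exists (fun g => (AB g).1), (fun g => (AB g).2).
split=> [g|g|g|f]; try by case: (AB_P g).
by case: (AB_P 1%g) => _ _ _ /(_ erefl).
Qed.

Lemma trunc_rep_intertwines A g (p : double_affine_weyl m) : intertwines m A g ->
  exists2 c : R[i], c != 0 &
    forall f, trunc_rep p (A f) = c *: A (trunc_rep (weyl_gamma p g) f).
Proof.
case: p => w h [_ Aw At]; exists (phase R X l (twist_exponent l g h))^-1 => [|f].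
  by rewrite invr_eq0 phase_neq0.
rewrite [trunc_rep (weyl_gamma _ _) _](trunc_repE w (heis_gamma h g)) Aw At trunc_repE.
by apply/funext => x; rewrite -[RHS]/(_ * (_ * _)) mulKf // phase_neq0.
Qed.

End MainTheorem.

Theorem proposition4p6 (R : realType) (X : affine_type) (m : denominator X)
    (l : nat) (l_gt0 : (0 < l)%N) :
  exists rho : gamma_double_affine_weyl m ->
      {linear trunc_poly R X l -> trunc_poly R X l},
    [/\ projective_representation rho,
        (forall (x : double_affine_weyl m) (f : trunc_poly R X l),
           rho (affine_elt x) f = trunc_rep x f),
        (forall (y : gamma_double_affine_weyl m) (n : double_affine_weyl m)
           (f : trunc_poly R X l),
           level_subgroup l n -> rho (y * affine_elt n)%g f = rho y f) &
        (forall (g : Gamma1 (tier X)) (w : weyl_group X) (f : trunc_poly R X l),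
           rho (gamma_elt m g) (rho (affine_elt (weyl_elt m w)) f) =
           rho (affine_elt (weyl_elt m w)) (rho (gamma_elt m g) f))].
Proof.
have k_gt0 : (0 < level X l)%N by rewrite ltn_addr.
have [A [B [Ag AK BK A1]]] := intertwiner_family R m k_gt0.
have linA g : linear (A g) by case: (Ag g).
have lin_rho (y : gamma_double_affine_weyl m) :
    linear (fun f : trunc_poly R X l => A y.1 (trunc_rep y.2 f)).
  by move=> c f f'; rewrite trunc_rep_linear linA.
exists (fun y => linear_pack (lin_rho y)); split.
- split.
    move=> y; exists (fun f => trunc_rep y.2^-1%g (B y.1 f)) => f.
      by rewrite -[linear_pack _ _]/(A y.1 _) AK trunc_repM mulVg trunc_rep1.
    by rewrite -[LHS]/(A y.1 _) trunc_repM mulgV trunc_rep1 BK.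
  have /choice[c cP] (yz : gamma_double_affine_weyl m * gamma_double_affine_weyl m) :
      exists c : R[i], c != 0 /\ forall f : trunc_poly R X l,
        A yz.1.1 (trunc_rep yz.1.2 (A yz.2.1 (trunc_rep yz.2.2 f))) =
        c *: A (yz.1.1 * yz.2.1)%g
                 (trunc_rep (weyl_gamma yz.1.2 yz.2.1 * yz.2.2)%g f).
    case: yz => [[g1 p1] [g2 p2]] /=.
    have [d d0 dE] := trunc_rep_intertwines p1 (Ag g2).
    have [c cE] := intertwiner_unique k_gt0 (intertwinesM (Ag g1) (Ag g2))
      (Ag (g1 * g2)%g) (AK _) (BK _).
    exists (d * c); split.
      (* A zero scalar would annihilate the range of an invertible operator. *)
      rewrite mulf_neq0 //; apply/eqP => c0.
      pose one : trunc_poly R X l := fun=> 1.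
      have := cE (B g2 (B g1 one)); rewrite BK BK c0 scale0r.
      move=> /(congr1 (fun f : trunc_poly R X l => f 0)).
      by move/eqP; rewrite oner_eq0.
    by move=> f; rewrite dE (linear_scale (linA g1)) cE scalerA trunc_repM.
  exists (fun y z => c (y, z)) => y z; first by case: (cP (y, z)).
  by move=> v; have [_ yz] := cP (y, z); exact: yz.
- by move=> x f; exact: A1.
- move=> y n f ln.
  rewrite -[LHS]/(A (y.1 * 1)%g (trunc_rep (weyl_gamma y.2 1%g * n)%g f)).
  by rewrite mulg1 weyl_gamma1 -trunc_repM (trunc_rep_level f ln).
- move=> g w f.
  have op_w_rep F : trunc_rep (weyl_elt m w) F = op_w w F.
    by apply: etrans (trunc_repE w 1%g F) _; rewrite heis_op1.
  rewrite -[LHS]/(A g (trunc_rep 1%g (A 1%g (trunc_rep (weyl_elt m w) f)))).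
  rewrite -[RHS]/(A 1%g (trunc_rep (weyl_elt m w) (A g (trunc_rep 1%g f)))).
  by rewrite !A1 !trunc_rep1 !op_w_rep; case: (Ag g).
Qed.
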